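(* Let $\Delta\ge 1$ and consider combinatorial auctions with bidder and item conflicts in which the bidder conflict graph $G$ has maximum out-degree $\Delta$ and the item conflict graph $G_I$ is arbitrary. A universally truthful (resp. truthful in expectation) $\alpha$-approximation mechanism for combinatorial auctions without conflicts can be turned into a universally truthful (resp. truthful in expectation) $(4\Delta\alpha)$-approximation mechanism for combinatorial auctions with bidder and item conflicts.
   Context: Combinatorial auction (CA): a finite set $B$ of $n$ bidders and a finite set $I$ of $m$ items; each bidder $i\in B$ has a valuation $v_i:2^I\to\mathbb{R}_{\ge 0}$ (private). An allocation is a tuple $S=(S_i)_{i\in B}$ of pairwise disjoint subsets of $I$. Without conflicts, the social welfare of $S$ is $\sum_{i\in B} v_i(S_i)$. CA with bidder and item conflicts: additionally there are public directed graphs $G=(B,E)$ (bidder conflict graph) and $G_I=(I,E_I)$ (item conflict graph). For an allocation $S$, let $D_i=\{k\in S_i \mid \exists j\in B,\ \exists \ell\in S_j:\ (i,j)\in E \text{ and } (k,\ell)\in E_I\}$, and $v_i^c(S)=v_i(S_i\setminus D_i)$. The social welfare is $\sum_{i\in B} v_i^c(S)$. A mechanism $(f,p)$ maps reported valuations to a (possibly random) allocation and payments; a bidder's utility is the value for the allocation ($v_i(S_i)$ without conflicts, $v_i^c(S)$ with conflicts) minus the payment. It is universally truthful if for each realization of its random choices truthful reporting is a dominant strategy for every bidder, and truthful in expectation if truthful reporting always maximizes each bidder's expected utility, whatever the others report. It is an $\alpha$-approximation mechanism if the expected social welfare under truthful reports is at least $1/\alpha$ times the maximum social welfare over all allocations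 (of the respective problem). Mechanisms are polynomial-time: if the given mechanism runs in polynomial time, the resulting one (using it as a subroutine) is required to run in polynomial time. *)

(* Defs.v *)
From HB Require Import structures.
From mathcomp Require Import all_boot all_order all_algebra.
From mathcomp Require Import all_classical all_reals all_analysis.

Set Implicit Arguments.
Unset Strict Implicit.
Unset Printing Implicit Defensive.

Import Order.TTheory GRing.Theory Num.Theory.
Local Open Scope ring_scope.

(** * Auctions

    The bidders are the elements of ['I_n], the items those of ['I_m]. *)

Record valuation (R : realType) (m : nat) : Type := Valuation {
  val_fun :> {set 'I_m} -> R;
  val_ge0 : forall S, 0 <= val_fun S
}.

Definition profile (R : realType) (n m : nat) : Type := 'I_n -> valuation R m.

Definition update (R : realType) (n m : nat) (v : profile R n m) (i : 'I_n)
    (u : valuation R m) : profile R n m :=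
  fun j => if j == i then u else v j.

Definition bundles (n m : nat) : Type := {ffun 'I_n -> {set 'I_m}}.

Definition is_allocation (n m : nat) (S : bundles n m) : bool :=
  [forall i, forall j, (i != j) ==> [disjoint S i & S j]].

(** An "effective bundle" map sends an allocation [S] and a bidder [i] to the
    set of items that count for [i]: [i] values [S] at [v_i (b S i)].  The map
    [plain_bundle] gives auctions without conflicts, [conflict_bundle E EI]
    auctions with bidder conflict graph [E] and item conflict graph [EI]. *)

Definition plain_bundle (n m : nat) (S : bundles n m) (i : 'I_n) :
    {set 'I_m} := S i.

Definition conflicting_items (n m : nat) (E : rel 'I_n) (EI : rel 'I_m)
    (S : bundles n m) (i : 'I_n) : {set 'I_m} :=
  [set k in S i | [exists j, exists l in S j, E i j && EI k l]]%SET.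

Definition conflict_bundle (n m : nat) (E : rel 'I_n) (EI : rel 'I_m)
    (S : bundles n m) (i : 'I_n) : {set 'I_m} :=
  S i :\: conflicting_items E EI S i.

Definition max_outdegree (n : nat) (E : rel 'I_n) : nat :=
  (\max_(i < n) #|[set j | E i j]%SET|)%N.

Definition welfare (R : realType) (n m : nat)
    (b : bundles n m -> 'I_n -> {set 'I_m})
    (v : profile R n m) (S : bundles n m) : R :=
  \sum_(i < n) v i (b S i).

(* Welfare is nonnegative and allocations exist, so the neutral value 0 does
   not affect the maximum. *)
Definition max_welfare (R : realType) (n m : nat)
    (b : bundles n m -> 'I_n -> {set 'I_m}) (v : profile R n m) : R :=
  \big[Num.max/0]_(S : bundles n m | is_allocation S) welfare b v S.

(** * Mechanisms

    The points of [outcomes] are the realizations of the random choices. *)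

Record mechanism (R : realType) (n m : nat) : Type := Mechanism {
  mech_disp : measure_display;
  outcomes : measurableType mech_disp;
  law : probability outcomes R;
  alloc : profile R n m -> outcomes -> bundles n m;
  pay : profile R n m -> outcomes -> 'I_n -> R;
  alloc_disjoint : forall v w, is_allocation (alloc v w);
  alloc_measurable : forall v S,
    measurable [set w | alloc v w = S]%classic;
  pay_measurable : forall v i,
    measurable_fun [set: outcomes]%classic (fun w => pay v w i)
}.

(** [utility b M i u v w] is the utility of a bidder [i] with true valuation
    [u] when the reports are [v] and the realization is [w]. *)
Definition utility (R : realType) (n m : nat)
    (b : bundles n m -> 'I_n -> {set 'I_m}) (M : mechanism R n m) (i : 'I_n)
    (u : valuation R m) (v : profile R n m) (w : outcomes M) : R :=
  u (b (alloc v w) i) - pay v w i.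

Definition universally_truthful (R : realType) (n m : nat)
    (b : bundles n m -> 'I_n -> {set 'I_m}) (M : mechanism R n m) : Prop :=
  forall (w : outcomes M) (i : 'I_n) (v : profile R n m) (u : valuation R m),
    utility b i (v i) (update v i u) w <= utility b i (v i) v w.

(* Integrability of the payments makes the expected utilities well defined. *)
Definition truthful_in_expectation (R : realType) (n m : nat)
    (b : bundles n m -> 'I_n -> {set 'I_m}) (M : mechanism R n m) : Prop :=
  (forall v i, (law M).-integrable [set: outcomes M]%classic
                 (fun w => (pay v w i)%:E)) /\
  (forall (i : 'I_n) (v : profile R n m) (u : valuation R m),
    ('E_(law M)[fun w : outcomes M => utility b i (v i) (update v i u) w] <=
     'E_(law M)[fun w : outcomes M => utility b i (v i) v w])%E).

Inductive truthfulness : Type := Universal | InExpectation.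

Definition truthful (t : truthfulness) (R : realType) (n m : nat)
    (b : bundles n m -> 'I_n -> {set 'I_m}) (M : mechanism R n m) : Prop :=
  match t with
  | Universal => universally_truthful b M
  | InExpectation => truthful_in_expectation b M
  end.

Definition approximates (R : realType) (n m : nat)
    (b : bundles n m -> 'I_n -> {set 'I_m}) (a : R) (M : mechanism R n m) :
    Prop :=
  forall v : profile R n m,
    ((a^-1 * max_welfare b v)%:E <=
     'E_(law M)[fun w : outcomes M => welfare b v (alloc v w)])%E.

(** * Randomized algorithms

    The machine is a unit-cost RAM programmed in a while language.  It has
    natural-number arrays and real arrays (the first index is the name of the
    array, fixed in the program text; the second is computed), and fair coins.
    There is no multiplication of naturals, so that unit cost is polynomially
    equivalent to Turing machine time, and no rounding of reals to naturals.
    The numbers of bidders and items and the two conflict graphs are readable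
    at unit cost; valuations are accessible only by querying the bidders. *)

Inductive nexp : Type :=
  | NConst of nat
  | Bidders
  | Items
  | BidderEdge of nexp & nexp
  | ItemEdge of nexp & nexp
  | NGet of nat & nexp
  | NAdd of nexp & nexp
  | NSub of nexp & nexp.

Inductive rexp : Type :=
  | RConst of nat
  | RGet of nat & nexp
  | RAdd of rexp & rexp
  | RSub of rexp & rexp
  | RMul of rexp & rexp
  | RDiv of rexp & rexp.

Inductive prog : Type :=
  | Skip
  | Seq of prog & prog
  | NSet of nat & nexp & nexp
  | RSet of nat & nexp & rexp
  | Flip of nat & nexp
  | Ask of nexp & nat & nexp & nat & nexp
  | If of nexp & prog & prog
  | IfLe of rexp & rexp & prog & prog
  | While of nexp & prog.

Definition message (R : realType) : Type := (seq nat * seq R)%type.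

(** A query model says how a bidder with a given valuation answers a query.
    For value queries, the query is the characteristic vector of a set [S] and
    the answer is [v S]; for demand queries, the query is a price vector [p]
    and the answer is the characteristic vector of some [S] maximizing
    [v S - \sum_(k in S) p k]. *)
Definition query_model (R : realType) : Type :=
  forall m : nat, valuation R m -> message R -> message R.

Record input (R : realType) : Type := Input {
  num_bidders : nat;
  num_items : nat;
  bidder_edge : nat -> nat -> bool;
  item_edge : nat -> nat -> bool;
  ask : nat -> message R -> message R
}.

Definition edge_code (n : nat) (E : rel 'I_n) (a b : nat) : bool :=
  match insub a, insub b with
  | Some i, Some j => E i j
  | _, _ => false
  end.

Definition make_input (R : realType) (q : query_model R) (n m : nat)
    (E : rel 'I_n) (EI : rel 'I_m) (v : profile R n m) : input R :=
  Input n m (edge_code E) (edge_code EI)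
    (fun a msg => if insub a is Some i then q m (v i) msg else ([::], [::])).

(* The list [coins] is the part of the coin sequence not yet consumed. *)
Record state (R : realType) : Type := State {
  nats : nat -> nat -> nat;
  reals : nat -> nat -> R;
  coins : seq bool
}.

Fixpoint neval (R : realType) (inp : input R) (st : state R) (e : nexp) : nat :=
  match e with
  | NConst k => k
  | Bidders => num_bidders inp
  | Items => num_items inp
  | BidderEdge e1 e2 => bidder_edge inp (neval inp st e1) (neval inp st e2)
  | ItemEdge e1 e2 => item_edge inp (neval inp st e1) (neval inp st e2)
  | NGet a e1 => nats st a (neval inp st e1)
  | NAdd e1 e2 => (neval inp st e1 + neval inp st e2)%N
  | NSub e1 e2 => (neval inp st e1 - neval inp st e2)%N
  end.

Fixpoint reval (R : realType) (inp : input R) (st : state R) (e : rexp) : R :=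
  match e with
  | RConst k => k%:R
  | RGet a e1 => reals st a (neval inp st e1)
  | RAdd e1 e2 => reval inp st e1 + reval inp st e2
  | RSub e1 e2 => reval inp st e1 - reval inp st e2
  | RMul e1 e2 => reval inp st e1 * reval inp st e2
  | RDiv e1 e2 => reval inp st e1 / reval inp st e2
  end.

(** Writes the list [s] at positions [k], [k + 1], ... of array [a]. *)
Definition store (T : Type) (f : nat -> nat -> T) (a k : nat) (s : seq T) :
    nat -> nat -> T :=
  fun b j => if (b == a) && (k <= j < k + size s)%N
             then nth (f b j) s (j - k) else f b j.

Definition set_nat (R : realType) (st : state R) (a k x : nat) : state R :=
  State (store (nats st) a k [:: x]) (reals st) (coins st).

Definition set_real (R : realType) (st : state R) (a k : nat) (x : R) :
    state R :=
  State (nats st) (store (reals st) a k [:: x]) (coins st).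

Definition flip_coin (R : realType) (st : state R) (a k : nat) : state R :=
  State (store (nats st) a k [:: nat_of_bool (head false (coins st))])
    (reals st) (behead (coins st)).

(** [exec inp p st t st']: started in [st], the program [p] halts in [st']
    after [t] steps.  [Ask e a l b k] sends to bidder [e] the first [l] entries
    of natural array [a] and the first [k] entries of real array [b], and the
    answer overwrites these arrays from position 0; its cost includes the
    length of the query and of the answer. *)
Inductive exec (R : realType) (inp : input R) :
    prog -> state R -> nat -> state R -> Prop :=
  | ExecSkip st : exec inp Skip st 1 st
  | ExecSeq p1 p2 st t1 st1 t2 st2 :
      exec inp p1 st t1 st1 -> exec inp p2 st1 t2 st2 ->
      exec inp (Seq p1 p2) st (t1 + t2)%N st2
  | ExecNSet a e x st :
      exec inp (NSet a e x) st 1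
        (set_nat st a (neval inp st e) (neval inp st x))
  | ExecRSet a e x st :
      exec inp (RSet a e x) st 1
        (set_real st a (neval inp st e) (reval inp st x))
  | ExecFlip a e st :
      exec inp (Flip a e) st 1 (flip_coin st a (neval inp st e))
  | ExecAsk e a l b k st xs ys zs ws :
      xs = mkseq (nats st a) (neval inp st l) ->
      ys = mkseq (reals st b) (neval inp st k) ->
      ask inp (neval inp st e) (xs, ys) = (zs, ws) ->
      exec inp (Ask e a l b k) st
        (1 + size xs + size ys + size zs + size ws)%N
        (State (store (nats st) a 0 zs) (store (reals st) b 0 ws) (coins st))
  | ExecIfTrue e p1 p2 st t st' :
      neval inp st e != 0%N -> exec inp p1 st t st' ->
      exec inp (If e p1 p2) st t.+1 st'
  | ExecIfFalse e p1 p2 st t st' :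
      neval inp st e = 0%N -> exec inp p2 st t st' ->
      exec inp (If e p1 p2) st t.+1 st'
  | ExecIfLeTrue x y p1 p2 st t st' :
      reval inp st x <= reval inp st y -> exec inp p1 st t st' ->
      exec inp (IfLe x y p1 p2) st t.+1 st'
  | ExecIfLeFalse x y p1 p2 st t st' :
      reval inp st y < reval inp st x -> exec inp p2 st t st' ->
      exec inp (IfLe x y p1 p2) st t.+1 st'
  | ExecWhileStop e p st :
      neval inp st e = 0%N -> exec inp (While e p) st 1 st
  | ExecWhileStep e p st t1 st1 t2 st2 :
      neval inp st e != 0%N ->
      exec inp p st t1 st1 -> exec inp (While e p) st1 t2 st2 ->
      exec inp (While e p) st (t1 + t2).+1%N st2.

Definition init_state (R : realType) (cs : seq bool) : state R :=
  State (fun _ _ => 0%N) (fun _ _ => 0) cs.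

(** Output convention: entry [k] of natural array 0 is [i.+1] when item [k] is
    given to bidder [i] (any other value leaves [k] unallocated), and entry
    [i] of real array 0 is the payment of bidder [i]. *)
Definition out_alloc (R : realType) (n m : nat) (st : state R) : bundles n m :=
  [ffun i : 'I_n => [set k : 'I_m | nats st 0 k == i.+1]%SET].

Definition out_pay (R : realType) (n : nat) (st : state R) (i : 'I_n) : R :=
  reals st 0 i.

(** With at most [K] steps, and for uniformly distributed coins [c], the
    program [p] draws the realization [phi c] of the random choices of [M] and
    computes the corresponding allocation and payments. *)
Definition computes (R : realType) (q : query_model R) (p : prog) (n m : nat)
    (E : rel 'I_n) (EI : rel 'I_m) (M : mechanism R n m) (K : nat) : Prop :=
  exists phi : K.-tuple bool -> outcomes M,
    (forall A : set (outcomes M), measurable A ->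
       law M A = (#|[pred c | phi c \in A]|%:R / 2 ^+ K)%:E) /\
    (forall (v : profile R n m) (c : K.-tuple bool),
       exists (t : nat) (st : state R),
         [/\ exec (make_input q E EI v) p (init_state R c) t st,
             (t <= K)%N,
             out_alloc n m st = alloc v (phi c) &
             forall i, out_pay st i = pay v (phi c) i]).

Definition no_edge (n : nat) : rel 'I_n := fun _ _ => false.

Definition polytime (R : realType) (q : query_model R)
    (M : forall n m : nat, mechanism R n m) : Prop :=
  exists (p : prog) (c d : nat), forall n m : nat,
    computes q p (@no_edge n) (@no_edge m) (M n m) (c * (n + m + 1) ^ d)%N.

(* The running time is bounded on graphs without self-loops only, i.e. when no
   bidder is in conflict with itself.  The bundles that a bidder with a
   self-loop can use without loss are those independent in the item conflict
   graph, so that a single such bidder already turns welfare maximization into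
   maximum-weight independent set. *)
Definition polytime_conflict (R : realType) (q : query_model R) (Delta : nat)
    (M : forall (n m : nat) (E : rel 'I_n) (EI : rel 'I_m), mechanism R n m) :
    Prop :=
  exists (p : prog) (c d : nat),
    forall (n m : nat) (E : rel 'I_n) (EI : rel 'I_m),
      irreflexive E -> max_outdegree E = Delta ->
      computes q p E EI (M n m E EI) (c * (n + m + 1) ^ d)%N.

(* Main.v *)
Require Import Defs.
From HB Require Import structures.
From mathcomp Require Import all_boot all_order all_algebra.
From mathcomp Require Import all_classical all_reals all_analysis.
From mathcomp Require Import measurable_realfun.
From mathcomp Require Import ring lra zify.

(** Every bidder becomes a candidate independently with probability
    [p = 2^-b], where [Delta < 2^b <= 2 Delta], and a candidate is selected
    when none of its out-neighbours is a candidate.  The selected bidders are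
    pairwise not in conflict, the selection ignores the reports, and each
    bidder is selected with probability at least
    [p (1 - p)^Delta >= 1 / (4 Delta)].  Running the given mechanism on the
    selected bidders only is therefore truthful, and restricting an optimal
    allocation (stripped of its conflicting items) to the selected bidders
    shows that it loses at most the factor [4 Delta].

    This is the mechanism used when the given mechanism is polynomial-time and
    no bidder is in conflict with itself; its random choices are the coins of
    the program.  In the other cases no bound on the running time is
    requested, and the Groves mechanism, which is truthful and optimal,
    suffices. *)

Set Implicit Arguments.
Unset Strict Implicit.
Unset Printing Implicit Defensive.

Import Order.TTheory GRing.Theory Num.Theory.

(** * Programs *)

(* Arrays 0 to 3 are reserved, and the arrays of the embedded program are
   shifted by 4.  Array 0 holds the output; entry [i] of array 1 tells whether
   bidder [i] is a candidate; entry [j + 1] of array 2 is [n - i] when [i] is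
   the [j]-th selected bidder, all other entries being 0, so that subtracting
   from [n] gives the bidder or the invalid index [n]; array 3 holds the number
   of selected bidders (0), two loop counters (1, 2), the verdict on the
   current bidder (3) and the last coin (4). *)
Fixpoint embed_nexp (e : nexp) : nexp :=
  match e with
  | NConst k => NConst k
  | Bidders => NGet 3 (NConst 0)
  | Items => Items
  | BidderEdge _ _ | ItemEdge _ _ => NConst 0
  | NGet a e => NGet (4 + a) (embed_nexp e)
  | NAdd e1 e2 => NAdd (embed_nexp e1) (embed_nexp e2)
  | NSub e1 e2 => NSub (embed_nexp e1) (embed_nexp e2)
  end.

Fixpoint embed_rexp (e : rexp) : rexp :=
  match e with
  | RConst k => RConst k
  | RGet a e => RGet (4 + a) (embed_nexp e)
  | RAdd e1 e2 => RAdd (embed_rexp e1) (embed_rexp e2)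
  | RSub e1 e2 => RSub (embed_rexp e1) (embed_rexp e2)
  | RMul e1 e2 => RMul (embed_rexp e1) (embed_rexp e2)
  | RDiv e1 e2 => RDiv (embed_rexp e1) (embed_rexp e2)
  end.

Definition renamed_bidder (e : nexp) : nexp :=
  NSub Bidders (NGet 2 (NAdd e (NConst 1))).

Fixpoint embed_prog (p : prog) : prog :=
  match p with
  | Skip => Skip
  | Seq p1 p2 => Seq (embed_prog p1) (embed_prog p2)
  | NSet a e x => NSet (4 + a) (embed_nexp e) (embed_nexp x)
  | RSet a e x => RSet (4 + a) (embed_nexp e) (embed_rexp x)
  | Flip a e => Flip (4 + a) (embed_nexp e)
  | Ask e a l b k => Ask (renamed_bidder (embed_nexp e))
      (4 + a) (embed_nexp l) (4 + b) (embed_nexp k)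
  | If e p1 p2 => If (embed_nexp e) (embed_prog p1) (embed_prog p2)
  | IfLe x y p1 p2 =>
      IfLe (embed_rexp x) (embed_rexp y) (embed_prog p1) (embed_prog p2)
  | While e p => While (embed_nexp e) (embed_prog p)
  end.

(** * Simulation of a program for the selected bidders inside the shifted arrays *)

Section Simulation.
Variables (R : realType) (inp INP : input R).
Variables (X : nat -> nat -> nat) (Y : nat -> nat -> R) (extra : seq bool).
Hypothesis X_bidders : X 3 0 = num_bidders inp.
Hypothesis items_eq : num_items INP = num_items inp.
Hypothesis no_bidder_edge : forall i j, bidder_edge inp i j = false.
Hypothesis no_item_edge : forall k l, item_edge inp k l = false.
Hypothesis ask_eq : forall e msg,
  ask INP (num_bidders INP - X 2 (e + 1)) msg = ask inp e msg.

Definition above (T : Type) (low f : nat -> nat -> T) : nat -> nat -> T :=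
  fun a j => if (a < 4)%N then low a j else f (a - 4)%N j.

(** Embedded programs write only to arrays from 4 on, so the reserved contents [X] and [Y] stay
    fixed along the simulation; [extra] stands for the coins that the simulated run never
    reaches. *)
Definition embed_state (st : state R) : state R :=
  State (above X (nats st)) (above Y (reals st)) (coins st ++ extra).

Lemma aboveE (T : Type) (low f : nat -> nat -> T) a j :
  above low f (4 + a) j = f a j.
Proof. by rewrite /above addKn. Qed.

Lemma above_store (T : Type) (low f : nat -> nat -> T) a k s :
  above low (store f a k s) = store (above low f) (4 + a) k s.
Proof.
apply/funext => b; apply/funext => j; rewrite /above /store.
case: ltnP => b4; first by rewrite (negbTE (_ : b != (4 + a)%N))//; lia.
by rewrite (_ : (b - 4 == a)%N = (b == 4 + a)%N)//; lia.
Qed.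

Lemma embed_nexpE st e :
  neval INP (embed_state st) (embed_nexp e) = neval inp st e.
Proof.
elim: e => //=.
- by move=> e1 _ e2 _; rewrite no_bidder_edge.
- by move=> e1 _ e2 _; rewrite no_item_edge.
- by move=> a e ->; exact: aboveE.
- by move=> e1 -> e2 ->.
- by move=> e1 -> e2 ->.
Qed.

Lemma embed_rexpE st e :
  reval INP (embed_state st) (embed_rexp e) = reval inp st e.
Proof.
elim: e => //= [a e|e1 -> e2 ->|e1 -> e2 ->|e1 -> e2 ->|e1 -> e2 ->] //.
by rewrite embed_nexpE; exact: aboveE.
Qed.

(* A halting run of at most [size (coins st)] steps never exhausts the coins,
   so appending [extra] ones does not change it. *)
Lemma embed_prog_exec p st t st' : exec inp p st t st' ->
  (t <= size (coins st))%N ->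
  exec INP (embed_prog p) (embed_state st) t (embed_state st') /\
  (size (coins st) <= size (coins st') + t)%N.
Proof.
elim=> {p st t st'} /=.
- by move=> st _; split; [exact: ExecSkip | lia].
- move=> p1 p2 st t1 st1 t2 st2 _ IH1 _ IH2 le.
  have [|e1 s1] := IH1; first lia.
  have [|e2 s2] := IH2; first lia.
  by split; [exact: ExecSeq e1 e2 | lia].
- move=> a e x st _; split; last by rewrite /=; lia.
  rewrite /embed_state /= above_store -!embed_nexpE; exact: ExecNSet.
- move=> a e x st _; split; last by rewrite /=; lia.
  rewrite /embed_state /= above_store -embed_nexpE -embed_rexpE; exact: ExecRSet.
- move=> a e st st1; split; last by rewrite /= size_behead; lia.
  rewrite [X in exec _ _ _ _ X](_ : _ = 
      flip_coin (embed_state st) (4 + a)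
        (neval INP (embed_state st) (embed_nexp e))); first exact: ExecFlip.
  rewrite /embed_state /flip_coin /= above_store embed_nexpE.
  by case: (coins st) st1.
- move=> e a l b k st xs ys zs ws xsE ysE askE _; split; last by rewrite /=; lia.
  rewrite /embed_state /= !above_store; apply: ExecAsk.
  + by rewrite embed_nexpE xsE; apply: eq_mkseq => j; exact: (esym (aboveE _ _ _ _)).
  + by rewrite embed_nexpE ysE; apply: eq_mkseq => j; exact: (esym (aboveE _ _ _ _)).
  + by rewrite /= embed_nexpE ask_eq.
- move=> e p1 p2 st t st' e0 _ IH le; have [|h s] := IH; first lia.
  by split; [apply: ExecIfTrue => //; rewrite embed_nexpE | lia].
- move=> e p1 p2 st t st' e0 _ IH le; have [|h s] := IH; first lia.
  by split; [apply: ExecIfFalse => //; rewrite embed_nexpE | lia].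
- move=> x y p1 p2 st t st' e0 _ IH le; have [|h s] := IH; first lia.
  by split; [apply: ExecIfLeTrue => //; rewrite !embed_rexpE | lia].
- move=> x y p1 p2 st t st' e0 _ IH le; have [|h s] := IH; first lia.
  by split; [apply: ExecIfLeFalse => //; rewrite !embed_rexpE | lia].
- by move=> e p st e0 _; split; [apply: ExecWhileStop; rewrite embed_nexpE | lia].
- move=> e p st t1 st1 t2 st2 e0 _ IH1 _ IH2 le.
  have [|e1 s1] := IH1; first lia.
  have [|e2 s2] := IH2; first lia.
  by split; [apply: ExecWhileStep e1 e2; rewrite embed_nexpE | lia].
Qed.

End Simulation.

(** * Total-correctness triples with a time bound, and counting loops *)

Section Hoare.
Variables (R : realType) (inp : input R).
Implicit Types (P Q : state R -> Prop) (st : state R).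

Definition triple P p T Q : Prop := forall st, P st ->
  exists t st', [/\ exec inp p st t st', (t <= T)%N & Q st'].

Lemma triple_weaken P P' Q Q' p T T' : triple P p T Q ->
  (forall st, P' st -> P st) -> (forall st, Q st -> Q' st) -> (T <= T')%N ->
  triple P' p T' Q'.
Proof.
move=> h PP QQ TT st /PP/h[t [st' [e l /QQ s]]].
by exists t, st'; split => //; lia.
Qed.

Definition For (x : nat) (e : nexp) (body : prog) : prog :=
  Seq (NSet 3 (NConst x) (NConst 0))
      (While (NSub e (NGet 3 (NConst x)))
        (Seq body (NSet 3 (NConst x) (NAdd (NGet 3 (NConst x)) (NConst 1))))).

Lemma nats_set_nat st a k y b j :
  nats (set_nat st a k y) b j = if (b == a) && (j == k) then y else nats st b j.
Proof.
rewrite /= /store /=; case: eqP => //= ->.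
rewrite (_ : (k <= j < k + 1)%N = (j == k)); last lia.
by case: eqP => // ->; rewrite subnn.
Qed.

(** The loop test reevaluates [e], hence its value must be [N] in every state. An iteration pays 2
    steps besides the body, for the test and the increment; the other 2 steps are the initialization
    and the final test. *)
Lemma triple_for (I : nat -> state R -> Prop) x e body N T :
  (forall st, neval inp st e = N) ->
  (forall i y st, I i st -> I i (set_nat st 3 x y)) ->
  (forall i, (i < N)%N ->
     triple (fun st => I i st /\ nats st 3 x = i) body T
            (fun st => I i.+1 st /\ nats st 3 x = i)) ->
  triple (I 0%N) (For x e body) (2 + N * T.+2) (I N).
Proof.
move=> eN stable step st I0.
(* Here [k] counts the iterations that remain; the induction is on it. *)
suff loop : forall k i st, (i + k)%N = N -> I i st -> nats st 3 x = i ->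
    exists t st', [/\ exec inp (While (NSub e (NGet 3 (NConst x)))
        (Seq body (NSet 3 (NConst x) (NAdd (NGet 3 (NConst x)) (NConst 1)))))
        st t st', (t <= k * T.+2 + 1)%N & I N st'].
  have [|||t [st' [ex l IN]]] := loop N 0%N (set_nat st 3 x 0); rewrite ?add0n//.
  - exact: stable.
  - by rewrite nats_set_nat !eqxx.
  exists (1 + t)%N, st'; split => //; last lia.
  by apply: ExecSeq ex; exact: ExecNSet.
elim=> [|k IH] i {I0}st.
  rewrite addn0 => -> IN xN; exists 1%N, st; split=> //.
  by apply: ExecWhileStop; rewrite /= eN xN subnn.
move=> ik Ii xi; have iN : (i < N)%N by rewrite -ik; lia.
have [t1 [st1 [ex1 l1 [I1 x1]]]] := step i iN st (conj Ii xi).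
have [|||t2 [st2 [ex2 l2 IN]]] := IH i.+1 (set_nat st1 3 x i.+1).
- by rewrite -ik; lia.
- exact: stable.
- by rewrite nats_set_nat !eqxx.
exists ((t1 + 1) + t2).+1, st2; split => //; last by nia.
apply: ExecWhileStep ex2; first by rewrite /= eN xi subn_eq0 -ltnNge.
apply: ExecSeq ex1 _.
have := ExecNSet inp 3 (NConst x) (NAdd (NGet 3 (NConst x)) (NConst 1)) st1.
by rewrite /= x1 addn1.
Qed.

End Hoare.

(** * The program that draws the selection, runs the given program and translates its output *)

(** Each bidder owns a block of [b] coins and is a candidate when all of them are false, which has
    probability [2^-b]; disjoint blocks give independence. *)
Definition candidate (b : nat) (c : seq bool) (i : nat) : bool :=
  ~~ has id (take b (drop (i * b) c)).

Local Arguments set_nat : simpl never.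
Local Arguments set_real : simpl never.
Local Arguments flip_coin : simpl never.

Definition scalar (x : nat) : nexp := NGet 3 (NConst x).

(** The depth [b] will depend on [Delta] alone, so this loop is unrolled in the program text.
    Subtraction is truncated: an entry that starts at 1 falls to 0 at the first true coin and stays
    there. *)
Fixpoint toss (b : nat) : prog :=
  if b is b'.+1 then
    Seq (Flip 3 (NConst 4))
      (Seq (NSet 1 (scalar 1) (NSub (NGet 1 (scalar 1)) (scalar 4))) (toss b'))
  else Skip.

Definition toss_all (b : nat) : prog :=
  For 1 Bidders (Seq (NSet 1 (scalar 1) (NConst 1)) (toss b)).

Definition check_neighbours : prog :=
  Seq (NSet 3 (NConst 3) (NGet 1 (scalar 1)))
    (For 2 Bidders
      (If (BidderEdge (scalar 1) (scalar 2))
        (NSet 3 (NConst 3) (NSub (scalar 3) (NGet 1 (scalar 2))))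
        Skip)).

Definition select_all : prog :=
  For 1 Bidders
    (Seq check_neighbours
      (If (scalar 3)
        (Seq (NSet 3 (NConst 0) (NAdd (scalar 0) (NConst 1)))
             (NSet 2 (scalar 0) (NSub Bidders (scalar 1))))
        Skip)).

Definition write_alloc : prog :=
  For 1 Items
    (NSet 0 (scalar 1)
      (NAdd (NSub Bidders (NGet 2 (NGet 4 (scalar 1)))) (NConst 1))).

(** The loop runs over all [n] indices: those past the selected bidders decode to [n] and write
    outside the payments that are read. Bidders that are not selected keep the initial payment 0. *)
Definition write_pay : prog :=
  For 1 Bidders (RSet 0 (renamed_bidder (scalar 1)) (RGet 4 (scalar 1))).

Definition conflict_prog (b : nat) (p : prog) : prog :=
  Seq (toss_all b) (Seq select_all (Seq (embed_prog p) (Seq write_alloc write_pay))).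

(** * Correctness and running time of each stage of the program *)

Section Correctness.
Variables (R : realType) (inp : input R).
Let n := num_bidders inp.
Let m := num_items inp.
Implicit Types st : state R.

(** What the embedded program needs from the selection stages: its own arrays still look initial,
    and [cs] are the coins left to it. *)
Definition clean (cs : seq bool) st : Prop :=
  [/\ forall a j, (3 < a)%N -> nats st a j = 0%N,
      forall a j, reals st a j = 0%R & coins st = cs].

Lemma clean_set_nat cs st a k x :
  (a <= 3)%N -> clean cs st -> clean cs (set_nat st a k x).
Proof.
move=> a3 [h1 h2 h3]; split => // a' j a'3; rewrite nats_set_nat h1//.
by case: eqP => // ?; lia.
Qed.

Lemma nats_flip_coin st a k b j : nats (flip_coin st a k) b j =
  if (b == a) && (j == k) then nat_of_bool (head false (coins st))
  else nats st b j.
Proof. exact: nats_set_nat. Qed.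

Lemma toss_exec b st : exists st',
  [/\ exec inp (toss b) st (2 * b + 1) st',
      reals st' = reals st, coins st' = drop b (coins st),
      nats st' 1 (nats st 3 1) =
        (nats st 1 (nats st 3 1) - count id (take b (coins st)))%N &
      forall a j, (a, j) != (3, 4) -> (a, j) != (1%N, nats st 3 1) ->
        nats st' a j = nats st a j].
Proof.
elim: b st => [|b IH] st.
  exists st; split => //; first exact: ExecSkip.
  - by rewrite drop0.
  - by rewrite take0 subn0.
pose st1 := flip_coin st 3 4.
pose st2 := set_nat st1 1 (nats st1 3 1) (nats st1 1 (nats st1 3 1) - nats st1 3 4).
have e31 : nats st1 3 1 = nats st 3 1 by rewrite nats_flip_coin.
have e34 : nats st1 3 4 = head false (coins st) by rewrite nats_flip_coin.
have e2 : nats st2 3 1 = nats st 3 1 by rewrite nats_set_nat; exact: e31.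
have [st' [ex rE cE vE frame]] := IH st2.
exists st'; split.
- have -> : (2 * b.+1 + 1 = 1 + (1 + (2 * b + 1)))%N by lia.
  apply: ExecSeq; first exact: ExecFlip.
  by apply: ExecSeq ex; exact: ExecNSet.
- by rewrite rE.
- by rewrite cE /= -drop1 drop_drop addn1.
(* Successive truncated subtractions amount to subtracting the sum, here the number of true
   coins. *)
- rewrite -e2 vE e2 nats_set_nat e31 e34 [nats st1 1 _]nats_flip_coin !eqxx /= -subnDA.
  by case: (coins st) => [|a s] //=; rewrite ?take_nil.
- move=> a j h34 h1; rewrite frame ?e2// nats_set_nat e31.
  move: h1; rewrite xpair_eqE => /negbTE ->.
  by rewrite nats_flip_coin; move: h34; rewrite xpair_eqE => /negbTE ->.
Qed.

Section Selection.
Variables (b : nat) (cs : seq bool).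

Let cand := candidate b cs.

Lemma toss_all_correct :
  triple inp (fun st => st = init_state R cs) (toss_all b)
    (2 + n * (2 * b + 4))
    (fun st => [/\ clean (drop (n * b) cs) st,
       forall j, (j < n)%N -> nats st 1 j = cand j,
       forall j, nats st 2 j = 0%N & nats st 3 0 = 0%N]).
Proof.
pose I i st := [/\ clean (drop (i * b) cs) st,
       forall j, (j < i)%N -> nats st 1 j = cand j,
       forall j, nats st 2 j = 0%N & nats st 3 0 = 0%N].
apply: (@triple_weaken _ _ (I 0%N) _ (I n) _ _
  (2 + n * (2 * b + 2).+2)) => //; last 2 first.
- by move=> st ->; split => //; split => //=; rewrite mul0n drop0.
- by nia.
apply: triple_for => // [i y st [h1 h2 h3 h4]|i iN st [[h1 h2 h3 h4] xi]].
  split; first exact: clean_set_nat.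
  - by move=> j ji; rewrite nats_set_nat h2.
  - by move=> j; rewrite nats_set_nat h3.
  - by rewrite nats_set_nat h4.
pose st1 := set_nat st 1 i 1.
have e31 : nats st1 3 1 = i by rewrite nats_set_nat.
have [st' [ex rE cE vE frame]] := toss_exec b st1.
rewrite e31 in vE frame.
exists (1 + (2 * b + 1))%N, st'; split; last 2 first.
- by lia.
- split; last by rewrite frame.
  have [z1 z2 z3] := h1.
  split.
  + split.
    * move=> a j a3; rewrite frame; last 2 first.
      - by rewrite xpair_eqE; lia.
      - by rewrite xpair_eqE; lia.
      by rewrite nats_set_nat z1//; case: eqP => // ?; lia.
    * by move=> a j; rewrite rE /=.
    * by rewrite cE /= z3 drop_drop mulSn.
  + move=> j; rewrite ltnS leq_eqVlt => /predU1P[->|ji].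
      rewrite vE nats_set_nat !eqxx /= z3 /cand /candidate has_count.
      by case: count => //= k; lia.
    rewrite frame ?xpair_eqE//; last lia.
    by rewrite nats_set_nat eqxx (ltn_eqF ji) h2.
  + by move=> j; rewrite frame ?xpair_eqE// nats_set_nat /= h3.
  + by rewrite frame// nats_set_nat /= h4.
- apply: ExecSeq ex.
  have := ExecNSet inp 1 (scalar 1) (NConst 1) st.
  by rewrite /= xi.
Qed.

Variable sel : nat -> bool.
Hypothesis selE : forall i, (i < n)%N ->
  sel i = cand i && all (fun j => ~~ (bidder_edge inp i j && cand j)) (iota 0 n).

Lemma check_neighbours_correct i st : (i < n)%N ->
    nats st 3 1 = i -> (forall j, (j < n)%N -> nats st 1 j = cand j) ->
  exists t st', [/\ exec inp check_neighbours st t st', (t <= 3 + n * 4)%N,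
    reals st' = reals st, coins st' = coins st &
    nats st' 3 3 = sel i /\
    forall a j, (a, j) != (3, 3) -> (a, j) != (3, 2) ->
        nats st' a j = nats st a j].
Proof.
move=> iN xi h1.
pose I k st' := [/\ reals st' = reals st, coins st' = coins st,
    nats st' 3 3 = cand i && all (fun j => ~~ (bidder_edge inp i j && cand j)) (iota 0 k) &
    forall a j, (a, j) != (3, 3) -> (a, j) != (3, 2) ->
        nats st' a j = nats st a j].
pose st1 := set_nat st 3 3 (nats st 1 i).
have [||||t [st' [ex l [rE cE vE frame]]]] :=
  @triple_for _ inp I 2 Bidders
    (If (BidderEdge (scalar 1) (scalar 2))
      (NSet 3 (NConst 3) (NSub (scalar 3) (NGet 1 (scalar 2)))) Skip)
    n 2 _ _ _ st1.
- by [].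
- move=> k y st' [rE cE vE frame]; split => //.
  by move=> a j a3 a2; rewrite nats_set_nat -xpair_eqE (negbTE a2) frame.
- move=> k kn st' [[rE cE vE frame] x2].
  have e31 : nats st' 3 1 = i by rewrite frame.
  have e1 : nats st' 1 k = cand k by rewrite frame// h1.
  rewrite /I -[k.+1]addn1 iotaD all_cat /= andbT add0n.
  have [Eik|Eik] := boolP (bidder_edge inp i k).
    exists 2%N, (set_nat st' 3 3 (nats st' 3 3 - nats st' 1 k)); split => //.
      apply: ExecIfTrue; first by rewrite /= e31 x2 Eik.
      have := ExecNSet inp 3 (NConst 3) (NSub (scalar 3) (NGet 1 (scalar 2))) st'.
      by rewrite /= x2.
    split; last by rewrite nats_set_nat.
    split => //.
      rewrite nats_set_nat !eqxx /= vE e1 andbA; case: (_ && _); by case: (cand k).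
    by move=> a j a3 a2; rewrite nats_set_nat -xpair_eqE (negbTE a3) frame.
  exists 2%N, st'; split => //.
    by apply: ExecIfFalse; [rewrite /= e31 x2 (negbTE Eik) | exact: ExecSkip].
  by split => //; split => //; rewrite andbT.
- split => //.
    by rewrite nats_set_nat !eqxx /= andbT h1.
  by move=> a j a3 a2; rewrite nats_set_nat -xpair_eqE (negbTE a3).
exists (1 + t)%N, st'; split => //.
- apply: ExecSeq ex.
  have := ExecNSet inp 3 (NConst 3) (NGet 1 (scalar 1)) st.
  by rewrite /= xi.
- by rewrite selE.
Qed.

Definition selection (i : nat) : seq nat := [seq j <- iota 0 i | sel j].

Definition codes (s : seq nat) : seq nat := 0%N :: [seq (n - j)%N | j <- s].

Definition selection_state i st : Prop :=
  [/\ clean (drop (n * b) cs) st,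
     forall j, (j < n)%N -> nats st 1 j = cand j,
     forall j, nats st 2 j = nth 0%N (codes (selection i)) j &
     nats st 3 0 = size (selection i)].

Lemma selectionS i :
  selection i.+1 = if sel i then rcons (selection i) i else selection i.
Proof.
rewrite /selection -addn1 iotaD filter_cat add0n /=.
by case: sel; rewrite ?cats1 ?cats0.
Qed.

Lemma select_all_correct :
  triple inp (selection_state 0) select_all (2 + n * (n * 4 + 8))
    (selection_state n).
Proof.
apply: (@triple_weaken _ _ (selection_state 0) _
  (selection_state n) _ _ (2 + n * (n * 4 + 6).+2)) => //; last first.
  by nia.
apply: (@triple_for _ inp selection_state 1 Bidders _ n (n * 4 + 6)) => //
  [i y st [h1 h2 h3 h4]|i iN st [[h1 h2 h3 h4] xi]].
  split; first exact: clean_set_nat.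
  - by move=> j ji; rewrite nats_set_nat h2.
  - by move=> j; rewrite nats_set_nat h3.
  - by rewrite nats_set_nat h4.
have [z1 z2 z3] := h1.
have [t [st1 [ex l rE cE [vE frame]]]] := check_neighbours_correct iN xi h2.
have cl1 : clean (drop (n * b) cs) st1.
  split => [a j a3|a j|]; rewrite ?rE ?cE// frame ?z1// xpair_eqE; lia.
have e31 : nats st1 3 1 = i by rewrite frame.
have e30 : nats st1 3 0 = size (selection i) by rewrite frame.
have seli : sel i = (nats st1 3 3 != 0)%N by rewrite vE; case: sel.
rewrite /selection_state selectionS.
case: (boolP (sel i)) => si; last first.
  exists (t + 2)%N, st1; split; last 2 first.
  - by lia.
  - split => //; split => //.
    + by move=> j jn; rewrite frame ?xpair_eqE// h2.
    + by move=> j; rewrite frame ?xpair_eqE// h3.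
  apply: ExecSeq ex _; apply: ExecIfFalse; last exact: ExecSkip.
  by rewrite /= vE (negbTE si).
pose st2 := set_nat st1 3 0 (size (selection i) + 1).
pose st3 := set_nat st2 2 (size (selection i) + 1) (n - i).
exists (t + 3)%N, st3; split; last 2 first.
- by lia.
- split; last by rewrite !nats_set_nat.
  split.
  + by do 2 (apply: clean_set_nat => //).
  + move=> j jn; rewrite !nats_set_nat; apply: etrans (h2 j jn); exact: frame.
  + move=> j; rewrite !nats_set_nat [nats st1 2 j]frame ?xpair_eqE// h3 eqxx /=.
    rewrite /codes map_rcons -rcons_cons nth_rcons /= size_map addn1.
    case: (ltngtP j (size (selection i)).+1) => // jl.
    by rewrite nth_default//= size_map ltnW.
  + by rewrite !nats_set_nat size_rcons addn1.
apply: ExecSeq ex _; apply: ExecIfTrue; first by rewrite /= vE si.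
apply: (@ExecSeq _ _ _ _ _ 1 st2 1).
  have := ExecNSet inp 3 (NConst 0) (NAdd (scalar 0) (NConst 1)) st1.
  by rewrite /= e30.
have := ExecNSet inp 2 (scalar 0) (NSub Bidders (scalar 1)) st2.
rewrite [neval _ _ _](_ : _ = (size (selection i) + 1)%N); last first.
  by rewrite /= /store.
rewrite [neval _ _ (NSub _ _)](_ : _ = (n - i)%N)//.
by rewrite [LHS](_ : _ = (n - nats st1 3 1)%N)// e31.
Qed.

(** The leading entry and the default of [codes] are both 0 and decode to the invalid index [n];
    elsewhere [n - (n - j) = j], as selected indices are below [n]. *)
Lemma decodeE y : n - nth 0 (codes (selection n)) y = nth n (n :: selection n) y.
Proof.
case: y => [|j] /=; first by rewrite subn0.
have [jl|jl] := ltnP j (size (selection n)); last first.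
  by rewrite !nth_default ?size_map// subn0.
rewrite (nth_map n)// subKn//.
have := mem_nth n jl; rewrite mem_filter mem_iota => /andP[_].
by move=> /andP[_ /ltnW].
Qed.

Lemma write_alloc_correct st0 :
  (forall j, nats st0 2 j = nth 0 (codes (selection n)) j) ->
  triple inp (fun st => st = st0) write_alloc (2 + m * 3)
    (fun st => [/\ reals st = reals st0,
       forall j, nats st 2 j = nth 0 (codes (selection n)) j &
       forall k, k < m -> nats st 0 k = (nth n (n :: selection n) (nats st0 4 k)).+1]).
Proof.
move=> h2.
pose I k st := [/\ reals st = reals st0,
  forall j, nats st 2 j = nth 0 (codes (selection n)) j,
  forall j, nats st 4 j = nats st0 4 j &
  forall j, j < k -> nats st 0 j = (nth n (n :: selection n) (nats st0 4 j)).+1].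
apply: (@triple_weaken _ _ (I 0) _ (I m) _ _ (2 + m * 3)) => //; last 2 first.
- by move=> st ->.
- by move=> st [].
apply: (@triple_for _ inp I 1 Items _ m 1) => //.
move=> k km st [[r1 r2 r3 r4] x1].
exists 1, (set_nat st 0 k (nth n (n :: selection n) (nats st0 4 k)).+1).
split => //; last first.
  split => //; split => // j.
  rewrite nats_set_nat eqxx ltnS leq_eqVlt => /predU1P[->|jk]; first by rewrite eqxx.
  by rewrite (ltn_eqF jk) r4.
have := ExecNSet inp 0 (scalar 1)
  (NAdd (NSub Bidders (NGet 2 (NGet 4 (scalar 1)))) (NConst 1)) st.
by rewrite /= x1 r3 r2 decodeE addn1.
Qed.

Lemma reals_set_real st a k y b' j :
  reals (set_real st a k y) b' j = if (b' == a) && (j == k) then y else reals st b' j.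
Proof.
rewrite /= /store /=; case: eqP => //= ->.
rewrite (_ : (k <= j < k + 1) = (j == k)); last lia.
by case: eqP => // ->; rewrite subnn.
Qed.

Lemma write_pay_correct st0 :
  (forall j, reals st0 0 j = 0%R) ->
  (forall j, nats st0 2 j = nth 0 (codes (selection n)) j) ->
  triple inp (fun st => st = st0) write_pay (2 + n * 3)
    (fun st => nats st 0 = nats st0 0 /\
       forall x, x < n -> reals st 0 x =
         if x \in selection n then reals st0 4 (index x (selection n)) else 0%R).
Proof.
move=> h0 h2.
have uL : uniq (selection n) by rewrite filter_uniq// iota_uniq.
have sL : size (selection n) <= n.
  by rewrite size_filter -[leqRHS](size_iota 0) count_size.
pose I i st := [/\ nats st 0 = nats st0 0,
  forall j, nats st 2 j = nth 0 (codes (selection n)) j,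
  forall j, reals st 4 j = reals st0 4 j &
  forall x, x < n -> reals st 0 x =
    if (x \in selection n) && (index x (selection n) < i)
    then reals st0 4 (index x (selection n)) else 0%R].
apply: (@triple_weaken _ _ (I 0) _ (I n) _ _ (2 + n * 3)) => //; last 2 first.
- by move=> st ->; split => // x _; rewrite andbF.
- move=> st [r1 r2 r3 r4]; split => // x xn; rewrite r4//.
  case: (boolP (x \in selection n)) => //= xL.
  by rewrite (leq_trans _ sL)// index_mem.
apply: (@triple_for _ inp I 1 Bidders _ n 1) => //.
move=> i iN st [[r1 r2 r3 r4] x1].
exists 1, (set_real st 0 (nth n (selection n) i) (reals st0 4 i)).
split => //; last first.
  split => //; split => // x xn.
  rewrite reals_set_real eqxx /= r4// [in RHS]ltnS [in RHS]leq_eqVlt.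
  (* Past the selected bidders the write hits entry [n], different from every [x < n], and all
     selected bidders have been served already. *)
  have [iL|iL] := ltnP i (size (selection n)); last first.
    rewrite nth_default//; case: (x =P n) => [?|_]; first lia.
    case: (boolP (x \in _)) => //=; rewrite -index_mem => xL.
    by rewrite (leq_trans xL iL) orbT.
  case: (x =P _) => [->|xi].
    by rewrite mem_nth// index_uniq// eqxx.
  case: (boolP (x \in selection n)) => //= xL.
  case: (_ =P i) => //= ix; case: xi.
  by rewrite -ix nth_index.
have := ExecRSet inp 0 (renamed_bidder (scalar 1)) (RGet 4 (scalar 1)) st.
by rewrite /= x1 r3 r2 decodeE addn1.
Qed.

Variables (small : input R) (p : prog) (coins_p extra : seq bool).
Hypothesis bidders_small : num_bidders small = size (selection n).
Hypothesis items_small : num_items small = m.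
Hypothesis no_bidder_edge : forall i j, bidder_edge small i j = false.
Hypothesis no_item_edge : forall k l, item_edge small k l = false.
Hypothesis ask_small : forall e msg,
  ask inp (nth n (selection n) e) msg = ask small e msg.
Hypothesis coins_eq : drop (n * b) cs = coins_p ++ extra.

Lemma conflict_prog_correct t st' :
  exec small p (init_state R coins_p) t st' -> t <= size coins_p ->
  exists t' st, [/\ exec inp (conflict_prog b p) (init_state R cs) t' st,
    t' <= t + (8 + n * (2 * b + n * 4 + 15) + m * 3),
    forall k, k < m -> nats st 0 k = (nth n (n :: selection n) (nats st' 0 k)).+1 &
    forall x, x < n -> reals st 0 x =
      if x \in selection n then reals st' 0 (index x (selection n)) else 0%R].
Proof.
move=> exs ts.
have [t1 [st1 [ex1 l1 [c1 a1 b1 d1]]]] := toss_all_correct (erefl (init_state R cs)).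
have [|t2 [st2 [ex2 l2 [[z1 z2 z3] _ b2 d2]]]] := @select_all_correct st1.
  by split => // j; rewrite b1 /codes /=; case: j => //= j; rewrite nth_nil.
pose emb := embed_state (nats st2) (reals st2) extra.
(* After the selection the state is exactly the embedding of an initial state, because [clean] keeps
   the arrays from 4 on at zero. *)
have st2E : emb (init_state R coins_p) = st2.
  rewrite /emb /embed_state /= -coins_eq -z3; case: (st2) z1 z2 => f g c /= z1 z2.
  congr State; apply/funext => a; apply/funext => j; rewrite /above.
    by case: ltnP => // a4; rewrite z1.
  by rewrite z2; case: ifP.
have [] := @embed_prog_exec _ small inp (nats st2) (reals st2) extra
  _ _ _ _ _ p _ _ _ exs ts.
- by rewrite d2 bidders_small.
- by rewrite items_small.
- by [].
- by [].
- by move=> e msg; rewrite b2 decodeE addn1 /= ask_small.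
rewrite -/emb st2E => ex3 _.
have [t4 [st4 [ex4 l4 [r4 b4 n4]]]] :=
  @write_alloc_correct (emb st') b2 _ (erefl (emb st')).
have r40 j : reals st4 0 j = 0%R by rewrite r4 /= /above /= z2.
have [t5 [st5 [ex5 l5 [n5 r5]]]] := write_pay_correct r40 b4 (erefl st4).
exists (t1 + (t2 + (t + (t4 + t5)))), st5; split.
- do 4 (apply: ExecSeq; first by eassumption).
  by [].
- by nia.
- by move=> k km; rewrite n5 n4// /= /above.
- by move=> x xn; rewrite r5// r4.
Qed.

End Selection.
End Correctness.

Local Open Scope ring_scope.

(** * Averages over coin sequences *)

Section Average.
Variable R : realFieldType.
Implicit Types (f g : seq bool -> R) (K : nat).

(** The mean of [f] over the [2^K] sequences of [K] coins. Working on lists instead of tuples makes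
    it possible to cut and concatenate blocks of coins without casts. *)
Fixpoint avg K f : R :=
  if K is K'.+1 then (avg K' (f \o cons false) + avg K' (f \o cons true)) / 2
  else f [::].

Lemma le_avg K f g :
  (forall c, size c = K -> f c <= g c) -> avg K f <= avg K g.
Proof.
elim: K f g => [|K IH] f g fg /=; first exact: fg.
by rewrite ler_pM2r ?invr_gt0// lerD// IH// => c cK; rewrite /= fg//= cK.
Qed.

Lemma eq_avg K f g :
  (forall c, size c = K -> f c = g c) -> avg K f = avg K g.
Proof. by move=> fg; apply/le_anti/andP; split; apply: le_avg => c /fg->. Qed.

Lemma avg_cst K (a : R) : avg K (fun=> a) = a.
Proof. by elim: K => //= K IH; rewrite !IH; field. Qed.

Lemma avgD K f g : avg K (fun c => f c + g c) = avg K f + avg K g.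
Proof.
elim: K f g => //= K IH f g.
by rewrite -mulrDl addrACA -!IH.
Qed.

Lemma avgZ K (a : R) f : avg K (fun c => a * f c) = a * avg K f.
Proof. by elim: K f => //= K IH f; rewrite mulrA mulrDr -!IH. Qed.

Lemma avg_sum K (I : Type) (r : seq I) (P : pred I) (F : I -> seq bool -> R) :
  avg K (fun c => \sum_(i <- r | P i) F i c) = \sum_(i <- r | P i) avg K (F i).
Proof.
elim: r => [|i r IH].
  by rewrite big_nil -[RHS](avg_cst K); apply: eq_avg => c _; rewrite big_nil.
rewrite big_cons -IH; case: ifPn => Pi; last first.
  by apply: eq_avg => c _; rewrite big_cons (negbTE Pi).
by rewrite -avgD; apply: eq_avg => c _; rewrite big_cons Pi.
Qed.

(** Fubini for two consecutive blocks of coins. *)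
Lemma avg_cat s t f :
  avg (s + t) f = avg s (fun c => avg t (fun c' => f (c ++ c'))).
Proof. by elim: s f => //= s IH f; rewrite !IH. Qed.

Lemma avg_take s t f : avg (s + t) (f \o take s) = avg s f.
Proof.
rewrite avg_cat; apply: eq_avg => c cs; rewrite -[RHS](avg_cst t).
by apply: eq_avg => c' _ /=; rewrite -cs take_size_cat.
Qed.

Lemma avg_tuple K f : avg K f = (\sum_(c : K.-tuple bool) f c) / 2 ^+ K.
Proof.
elim: K f => [|K IH] f /=.
  rewrite (eq_bigr (fun=> f [::])) => [|c _]; last by rewrite tuple0.
  by rewrite sumr_const card_tuple expn0 mulr1n divr1.
have -> : \sum_(c : K.+1.-tuple bool) f c =
    \sum_(bc : bool * K.-tuple bool) f (bc.1 :: bc.2).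
  rewrite (reindex (fun bc : bool * K.-tuple bool => cons_tuple bc.1 bc.2))//=.
  exists (fun c => (thead c, behead_tuple c)).
    by case=> a c _ /=; congr pair; apply: val_inj.
  by move=> c _; rewrite [in RHS](tuple_eta c); apply: val_inj.
rewrite -(pair_bigA _ (fun a (c : K.-tuple bool) => f (a :: c))) /=.
rewrite big_bool /= !IH exprS.
have ? : (2 ^+ K : R) != 0 by rewrite expf_neq0.
by rewrite /comp; field.
Qed.

End Average.

(** * Independence of the candidates and the probability of being selected *)

Section Candidates.
Variables (R : realFieldType) (b : nat).

Let p : R := (2 ^+ b)^-1.

Lemma avg_no_head k (x y : R) :
  avg k (fun c => if has id c then y else x) = x / 2 ^+ k + y * (1 - 1 / 2 ^+ k).
Proof.
elim: k => [|k IH]; first by rewrite /= expr0 !divr1 subrr mulr0 addr0.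
(* A true first coin settles the value [y]; only a false one leaves the question open. *)
transitivity ((avg k (fun c => if has id c then y else x) + avg k (fun=> y)) / 2).
  by [].
have ? : (2 ^+ k : R) != 0 by rewrite expf_neq0.
by rewrite avg_cst IH exprS; field.
Qed.

(** The candidate bits are independent Bernoulli variables of parameter [p], since they read
    disjoint blocks; hence the mean of a product factors. *)
Lemma avg_candidates n (F : nat -> bool -> R) :
  avg (n * b) (fun c => \prod_(i < n) F i (candidate b c i)) =
  \prod_(i < n) (p * F i true + (1 - p) * F i false).
Proof.
elim: n F => [|n IH] F; first by rewrite /= !big_ord0.
have avg0 : avg b (fun c => F 0%N (~~ has id c)) = 
    p * F 0%N true + (1 - p) * F 0%N false.
  rewrite (eq_avg (g := fun c => if has id c then F 0%N false else F 0%N true)).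
    by rewrite avg_no_head /p; ring.
  by move=> c _; case: has.
rewrite mulSn avg_cat [RHS]big_ord_recl -avg0 -(IH (fun i => F i.+1)) mulrC -avgZ.
apply: eq_avg => c cb; rewrite mulrC -avgZ; apply: eq_avg => c' _.
rewrite big_ord_recl {1}/candidate mul0n drop0 -{1}cb take_size_cat//; congr (_ * _).
apply: eq_bigr => i _; rewrite /candidate lift0 mulSn.
by rewrite [(b + _)%N]addnC -drop_drop -cb drop_size_cat.
Qed.

Variable n : nat.
Variable E : rel 'I_n.

Definition selected (c : seq bool) : {set 'I_n} :=
  [set i : 'I_n | candidate b c i & [forall j, E i j ==> ~~ candidate b c j]]%SET.

Lemma selected_independent c i j :
  i \in selected c -> j \in selected c -> ~~ E i j.
Proof.
by rewrite !inE => /andP[_ /forallP/(_ j)] + /andP[cj _]; rewrite cj implybF.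
Qed.

(** Without a self-loop at [i], selection is a conjunction of conditions on distinct bidders: [i] is
    a candidate and its out-neighbours are not. With a self-loop it would be impossible. *)
Lemma avg_selected i : ~~ E i i ->
  avg (n * b) (fun c => (i \in selected c)%:R) =
  p * (1 - p) ^+ #|[set j | E i j]%SET| :> R.
Proof.
move=> Eii.
(* One factor per bidder, whose product is the indicator of the selection of [i]. *)
pose F (k : nat) (x : bool) : R :=
  if insub k is Some j then
    if j == i then x%:R else if E i j then (~~ x)%:R else 1
  else 1.
have FE (j : 'I_n) x : F j x = if j == i then x%:R else if E i j then (~~ x)%:R else 1.
  by rewrite /F valK.
rewrite (eq_avg (g := fun c => \prod_(j < n) F j (candidate b c j))); last first.
  move=> c _; rewrite inE (bigD1 i)//= FE eqxx.
  case: (candidate b c i) => /=; last by rewrite mul0r.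
  rewrite mul1r; case: forallP => [h|/forallP].
    rewrite big1// => j /negbTE ji; rewrite FE ji.
    by case: ifP => // Eij; have := h j; rewrite Eij /= => ->.
  rewrite negb_forall => /existsP[j]; rewrite negb_imply negbK => /andP[Eij cj].
  have ji : j != i by apply: contraNneq Eii => ji; rewrite -{2}ji.
  by rewrite (bigD1 j)//= FE (negbTE ji) Eij cj /= mul0r.
rewrite avg_candidates (bigD1 i)//= !FE eqxx /= mulr1 mulr0 addr0; congr (_ * _).
rewrite -prodr_const [RHS]big_mkcond /= [RHS](bigD1 i)//= inE (negbTE Eii) mul1r.
apply: eq_bigr => j /negbTE ji; rewrite !FE ji inE; case: ifP => _ /=.
  by rewrite mulr0 add0r mulr1.
by rewrite !mulr1 addrC subrK.
Qed.

End Candidates.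

(** * The numerical lower bound on the selection probability *)

Section SelectionProbability.
Variable R : realFieldType.

(* Bernoulli's bound [1 - D p] is too weak when [D p] is close to 1; this is
   Bernoulli for the exponent [D / 2], squared. *)
Lemma exp_complement_ge (p : R) D : (2 <= D)%N -> 0 <= p -> D%:R * p <= 1 ->
  (1 - D%:R * p / 2) ^+ 2 <= (1 - p) ^+ D.
Proof.
move=> D2 p0; elim: D D2 => // -[|[|D]] // IH _ Dp.
  rewrite (_ : 1 - _ = 1 - p)//; by field.
have Dp' : D.+2%:R * p <= 1.
  by apply: le_trans Dp; rewrite ler_wpM2r// ler_nat.
have D2 : 2 <= D.+2%:R :> R by rewrite ler_nat.
have p1 : p <= 1 by nra.
apply: (@le_trans _ _ ((1 - p) * (1 - D.+2%:R * p / 2) ^+ 2)); last first.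
  by rewrite [leRHS]exprS ler_wpM2l ?IH// subr_ge0.
rewrite -[D.+3]addn1 natrD in Dp *; set d : R := D.+2%:R in D2 Dp Dp' *.
(* With [a = 1 - d p / 2], the right side minus the left side of the goal is
   [p^2 (2 a d - 1) / 4]. *)
have h : 1 <= 2 * (1 - d * p / 2) * d by nra.
have h2 : p * 1 <= p * (2 * (1 - d * p / 2) * d) by rewrite ler_wpM2l.
nra.
Qed.

Definition coin_depth (D : nat) : nat := (trunc_log 2 D).+1.

(** The worst case is [k = D]. For [D >= 2], put [x = D p], which lies between [1/2] and 1;
    [exp_complement_ge] reduces the claim to [4 x (1 - x/2)^2 >= 1], an equality at [x = 1]. For
    [D = 1], [p = 1/2] gives equality. *)
Lemma selection_ge (D k : nat) : (0 < D)%N -> (k <= D)%N ->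
  (4 * D%:R)^-1 <=
  (2 ^+ coin_depth D)^-1 * (1 - (2 ^+ coin_depth D)^-1) ^+ k :> R.
Proof.
move=> D0 kD; set p : R := (2 ^+ _)^-1.
have lo : (D < 2 ^ coin_depth D)%N by rewrite trunc_log_ltn.
have hi : (2 ^ coin_depth D <= 2 * D)%N by rewrite expnS leq_mul2l trunc_logP.
have q0 : 0 < 2 ^+ coin_depth D :> R by rewrite exprn_gt0.
have p0 : 0 < p by rewrite invr_gt0.
have d0 : 0 < D%:R :> R by rewrite ltr0n.
have pq : p * 2 ^+ coin_depth D = 1 by rewrite mulVf// gt_eqF.
have x1 : D%:R * p <= 1.
  by rewrite -[leRHS]pq mulrC (ler_wpM2l (ltW p0))// -natrX ler_nat ltnW.
have x2 : 1 <= 2 * (D%:R * p).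
  rewrite mulrA mulrC -[leLHS]pq (ler_wpM2l (ltW p0))// -natrX.
  by rewrite -[2]/(2%:R) -natrM ler_nat.
have p1 : p <= 1 by apply: le_trans x1; rewrite (ler_peMl (ltW p0))// ler1n.
have pk : (1 - p) ^+ D <= (1 - p) ^+ k.
  by apply: ler_wiXn2l => //; lra.
apply: (@le_trans _ _ (p * (1 - p) ^+ D)); last by rewrite (ler_wpM2l (ltW p0)).
rewrite -div1r ler_pdivrMr ?mulr_gt0//.
case: D D0 lo hi p pq p0 d0 x1 x2 p1 kD pk {q0} =>
  [|[|D]] // _ lo hi p pq p0 d0 x1 x2 p1 kD pk; first by nra.
have := exp_complement_ge (isT : (2 <= D.+2)%N) (ltW p0) x1.
set x := _ * p in x1 x2 *; set y := _ ^+ D.+2 => xy.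
suff : 1 / 4 <= x * (1 - x / 2) ^+ 2.
  move=> h; have : x * (1 - x / 2) ^+ 2 <= x * y by rewrite ler_wpM2l// /x; nra.
  rewrite (_ : p * y * _ = 4 * (x * y)); last by rewrite /x; ring.
  lra.
(* [4 x (1 - x / 2)^2 - 1] factors as [(1 - x) (- x^2 + 3 x - 1)] *)
have : 0 <= (1 - x) * (- x ^+ 2 + 3 * x - 1) by apply: mulr_ge0; nra.
nra.
Qed.

End SelectionProbability.

(** * The uniform probability on coin tuples, with the discrete sigma-algebra *)

Definition coin_space (K : nat) : Type := K.-tuple bool.

HB.instance Definition _ K := Finite.on (coin_space K).
HB.instance Definition _ K := isPointed.Build (coin_space K) (nseq_tuple K false).
HB.instance Definition _ K := @isMeasurable.Build default_measure_display
  (coin_space K) discrete_measurable discrete_measurable0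
  discrete_measurableC discrete_measurableU.

Section CoinLaw.
Variables (R : realType) (K : nat).
Local Open Scope ereal_scope.

Lemma coin_weight_ge0 : (0 <= (2 ^+ K)^-1 :> R)%R.
Proof. by rewrite invr_ge0 exprn_ge0. Qed.

(** The uniform law as a finite sum of weighted Dirac masses, a form in which integrals become
    finite sums. *)
Definition coin_law : set (coin_space K) -> \bar R :=
  msum (fun k => mscale (NngNum coin_weight_ge0)
                        (dirac (nth point (enum {: coin_space K}) k)))
       #|{: coin_space K}|.

HB.instance Definition _ := Measure.on coin_law.

Lemma sum_coin_space (f : coin_space K -> R) :
  (\sum_(k < #|{: coin_space K}|) f (nth point (enum {: coin_space K}) k) =
   \sum_c f c)%R.
Proof.
rewrite -(big_mkord xpredT (fun k => f (nth point (enum {: coin_space K}) k))).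
by rewrite cardE -(big_nth point xpredT) big_enum.
Qed.

Lemma coin_lawE A :
  coin_law A = (#|[pred c | c \in A]|%:R / 2 ^+ K)%:E.
Proof.
rewrite /coin_law /msum /= /mscale /=.
under eq_bigr do rewrite diracE -EFinM.
rewrite sumEFin (sum_coin_space (fun c => (2 ^+ K)^-1 * (c \in A)%:R)%R).
rewrite -mulr_sumr mulrC -sum1_card natr_sum [in RHS]big_mkcond /=.
by under [in RHS]eq_bigr do rewrite -mulrb.
Qed.

Lemma coin_law_setT : coin_law setT = 1.
Proof.
rewrite coin_lawE (eq_card (B := {: coin_space K})) => [|c]; last first.
  by rewrite !inE; exact/mem_set.
by rewrite card_tuple card_bool natrX divff// expf_neq0.
Qed.

HB.instance Definition _ :=
  @Measure_isProbability.Build _ _ R coin_law coin_law_setT.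

Lemma integral_coin_law_ge0 (f : coin_space K -> R) : (forall c, 0 <= f c)%R ->
  \int[coin_law]_c (f c)%:E = ((\sum_c f c) / 2 ^+ K)%:E.
Proof.
move=> f0; rewrite ge0_integral_measure_sum//=; last by move=> c _; rewrite lee_fin.
under eq_bigr => k _.
  rewrite ge0_integral_mscale//=; last by move=> c _; rewrite lee_fin.
  rewrite integral_dirac//= diracT mul1e -EFinM; over.
rewrite sumEFin (sum_coin_space (fun c => (2 ^+ K)^-1 * f c)%R).
by rewrite -mulr_sumr mulrC.
Qed.

Lemma integral_coin_law (f : coin_space K -> R) :
  \int[coin_law]_c (f c)%:E = ((\sum_c f c) / 2 ^+ K)%:E.
Proof.
rewrite integralE.
under eq_integral do rewrite funeposE -EFin_max.
under [X in _ - X]eq_integral do rewrite funenegE -EFin_max.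
rewrite !integral_coin_law_ge0; last 2 first.
- by move=> c; rewrite le_max lexx orbT.
- by move=> c; rewrite le_max lexx orbT.
rewrite -EFinB -mulrBl -sumrB; congr (_ / _)%:E; apply: eq_bigr => c _.
by rewrite /Num.max; case: ifPn; case: ifPn; lra.
Qed.

Lemma integrable_coin_law (f : coin_space K -> R) :
  coin_law.-integrable setT (EFin \o f).
Proof.
apply/integrableP; split => //.
under eq_integral do rewrite /=.
by rewrite (integral_coin_law (fun c => `|f c|%R)) ltry.
Qed.

End CoinLaw.

Arguments coin_law : clear implicits.

(** * Expectations under laws generated by coins *)

Section Expectation.
Variable R : realType.
Local Open Scope ereal_scope.

Lemma expectation_coin_law K (f : coin_space K -> R) :
  'E_(coin_law R K)[f] = ((\sum_c f c) / 2 ^+ K)%:E.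
Proof. by rewrite unlock integral_coin_law. Qed.

Lemma expectation_coins K (f : seq bool -> R) :
  'E_(coin_law R K)[fun c : coin_space K => f c] = (avg K f)%:E.
Proof. by rewrite expectation_coin_law avg_tuple. Qed.

Variables (d : measure_display) (T : measurableType d) (P : probability T R).
Variables (K : nat) (phi : K.-tuple bool -> T).
Hypothesis lawP : forall A, measurable A ->
  P A = (#|[pred c | phi c \in A]|%:R / 2 ^+ K)%:E.

(** By [lawP], [P] is the pushforward of the coin law along [phi], so this is a change of variables;
    [phi] is measurable because its source is discrete. *)
Lemma expectation_generated (f : T -> R) : measurable_fun setT f ->
  'E_P[f] = ((\sum_c f (phi c)) / 2 ^+ K)%:E.
Proof.
move=> mf.
have mphi : measurable_fun [set: coin_space K] (phi : coin_space K -> T) by [].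
rewrite unlock (eq_measure_integral
  (pushforward (coin_law R K) (phi : coin_space K -> T))); last first.
  by move=> A mA _; apply: etrans (lawP mA) (esym (coin_lawE _ _)).
apply: etrans (integral_pushforward mphi _ _ _) _ => //.
- exact/measurable_EFinP.
- exact: integrable_coin_law.
- by rewrite preimage_setT (integral_coin_law (f \o phi)).
Qed.

End Expectation.

(** * Mechanisms *)

Section Welfare.
Variables (R : realType) (n m : nat).
Implicit Types (b : bundles n m -> 'I_n -> {set 'I_m}) (v : profile R n m).

Lemma max_welfare_ge b v S :
  is_allocation S -> welfare b v S <= max_welfare b v.
Proof. by move=> aS; rewrite /max_welfare (bigmax_sup S). Qed.

Lemma welfare_ge0 b v S : 0 <= welfare b v S.
Proof. by apply: sumr_ge0 => i _; exact: val_ge0. Qed.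

Lemma max_welfare_le b v x : 0 <= x ->
  (forall S, is_allocation S -> welfare b v S <= x) -> max_welfare b v <= x.
Proof. by move=> x0 h; apply/bigmax_leP; split. Qed.

Lemma empty_allocation : is_allocation ([ffun=> finset.set0] : bundles n m).
Proof.
apply/forallP => i; apply/forallP => j.
by rewrite !ffunE -finset.setI_eq0 finset.set0I eqxx implybT.
Qed.

Lemma sub_allocation (S T : bundles n m) :
  (forall i, T i \subset S i) -> is_allocation S -> is_allocation T.
Proof.
move=> TS /forallP aS; apply/forallP => i; apply/forallP => j; apply/implyP => ij.
have /forallP/(_ j) := aS i; rewrite ij /= => dS.
exact: disjointW (TS i) (TS _) dS.
Qed.

(** There are finitely many allocations, so each preimage is a finite union of the events that
    [alloc_measurable] covers. *)
Lemma allocation_measurable (M : mechanism R n m) v (g : bundles n m -> R) :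
  measurable_fun setT (fun w : outcomes M => g (alloc v w)).
Proof.
move=> _ Y mY; rewrite setTI.
rewrite (_ : _ @^-1` _ =
  \bigcup_(S in [set S | Y (g S)]) [set w | alloc v w = S])%classic.
  apply: fin_bigcup_measurable => [|S _]; first exact: finite_finset.
  exact: alloc_measurable.
apply/seteqP; split => [w Yw|w [S YS wS]] /=; last by rewrite wS.
by exists (alloc v w).
Qed.

Lemma welfare_measurable (M : mechanism R n m) b v :
  measurable_fun setT (fun w : outcomes M => welfare b v (alloc v w)).
Proof. exact: allocation_measurable. Qed.

Lemma utility_measurable (M : mechanism R n m) b i u v :
  measurable_fun setT (utility b (M := M) i u v).
Proof.
apply: measurable_funB; last exact: pay_measurable.
exact: (allocation_measurable v (fun S => u (b S i))).
Qed.

Lemma update_same v i u : update v i u i = u.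
Proof. by rewrite /update eqxx. Qed.

End Welfare.

Section CoinMechanism.
Variables (R : realType) (n m K : nat).
Variable al : profile R n m -> seq bool -> bundles n m.
Variable pa : profile R n m -> seq bool -> 'I_n -> R.
Hypothesis al_disjoint : forall v c, is_allocation (al v c).

(** Allocation and payments read plain lists of coins, so that they can be defined without reference
    to [K]. *)
Definition coin_mechanism : mechanism R n m :=
  @Mechanism R n m default_measure_display (coin_space K) (coin_law R K)
    (fun v c => al v c) (fun v c => pa v c) (fun v c => al_disjoint v c)
    (fun _ _ => I) (fun _ _ _ _ _ => I).

End CoinMechanism.

(** * The Groves mechanism *)

Section Groves.
Variables (R : realType) (n m : nat) (b : bundles n m -> 'I_n -> {set 'I_m}).

Definition best_allocation (v : profile R n m) : bundles n m :=
  [arg max_(S > [ffun=> finset.set0] | is_allocation S) welfare b v S]%O.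

Lemma best_allocationP v : is_allocation (best_allocation v) /\
  forall S, is_allocation S -> welfare b v S <= welfare b v (best_allocation v).
Proof.
by rewrite /best_allocation; case: arg_maxP; first exact: empty_allocation.
Qed.

(** With 0 coins it is deterministic. Each bidder receives the reported welfare of the others, so
    that its utility is the total welfare for its true valuation and the reports of the others. *)
Definition groves : mechanism R n m :=
  @coin_mechanism R n m 0 (fun v _ => best_allocation v)
    (fun v _ i => - \sum_(j < n | j != i) v j (b (best_allocation v) j))
    (fun v _ => (best_allocationP v).1).

Lemma groves_utility i u v w : utility b (M := groves) i u v w =
  welfare b (update v i u) (best_allocation v).
Proof.
rewrite /utility /= opprK /welfare [RHS](bigD1 i)//= update_same; congr (_ + _).
by apply: eq_bigr => j /negbTE ji; rewrite /update ji.
Qed.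

Lemma groves_universally_truthful : universally_truthful b groves.
Proof.
move=> w i v u; rewrite !groves_utility.
have -> : update (update v i u) i (v i) = v.
  by apply/funext => j; rewrite /update; case: eqP => // ->.
have -> : update v i (v i) = v.
  by apply/funext => j; rewrite /update; case: eqP => // ->.
exact: (best_allocationP v).2 (best_allocationP _).1.
Qed.

Lemma groves_truthful t : truthful t b groves.
Proof.
case: t; first exact: groves_universally_truthful.
split=> [v i|i v u]; first exact: integrable_coin_law.
rewrite !(@expectation_coin_law R 0) lee_fin ler_wpM2r ?invr_ge0 ?exprn_ge0//.
by apply: ler_sum => w _; exact: groves_universally_truthful.
Qed.

(** The optimum is attained, so every factor [a >= 1] is fine; without bidders all welfares are 0
    and any positive factor is. *)
Lemma groves_approximates a : 0 < a -> (n = 0%N \/ 1 <= a) ->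
  approximates b a groves.
Proof.
move=> a0 na v; rewrite (@expectation_coin_law R 0) lee_fin.
have opt : max_welfare b v <= welfare b v (best_allocation v).
  apply: max_welfare_le; first exact: welfare_ge0.
  exact: (best_allocationP v).2.
rewrite (eq_bigr (fun=> welfare b v (best_allocation v)))// sumr_const.
rewrite (card_tuple 0 bool) expn0 mulr1n divr1.
apply: le_trans opt; rewrite ler_pdivrMl//.
have max0 : 0 <= max_welfare b v.
  apply: le_trans (max_welfare_ge b v (empty_allocation n m)).
  exact: welfare_ge0.
case: na => [n0|]; last by move=> a1; rewrite ler_peMl.
apply: le_trans (mulr_ge0 (ltW a0) max0).
apply: max_welfare_le => // S _.
rewrite /welfare big1// => i _.
by have := ltn_ord i; rewrite {2}n0.
Qed.

End Groves.

(* All valuations constantly 1 give the same positive welfare to all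
   allocations. *)
Lemma approximates_ge1 (R : realType) (n m : nat) (a : R) (M : mechanism R n m) :
  0 < a -> (0 < n)%N -> approximates (@plain_bundle n m) a M -> 1 <= a.
Proof.
move=> a0 n0 aM; pose v : profile R n m := fun=> Valuation (fun=> ler01 : 0 <= 1).
have w S : welfare (@plain_bundle n m) v S = n%:R :> R.
  by rewrite /welfare /= sumr_const card_ord.
have := aM v.
rewrite (_ : (fun _ => _) = cst n%:R); last by apply/funext => ?; rewrite w.
rewrite expectation_cst lee_fin ler_pdivrMl// => h.
have : n%:R <= a * n%:R :> R.
  apply: le_trans h; rewrite -(w [ffun=> finset.set0]).
  exact/max_welfare_ge/empty_allocation.
by rewrite ler_pMl// ltr0n.
Qed.

(** * Restricting an auction to a set of bidders and extending its outcome back *)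

Section ConflictMechanism.
Variables (R : realType) (n m : nat) (E : rel 'I_n) (EI : rel 'I_m).

Section Restriction.
Variable S : {set 'I_n}.

Definition restrict (v : profile R n m) : profile R #|S| m :=
  fun j => v (enum_val j).

(** The union has at most one term, [enum_val] being injective; it treats bidders inside and outside
    [S] alike, without a membership proof. *)
Definition extend_alloc (A : bundles #|S| m) : bundles n m :=
  [ffun i => \bigcup_(j < #|S| | enum_val j == i) A j]%SET.

Definition extend_pay (p : 'I_#|S| -> R) (i : 'I_n) : R :=
  \sum_(j < #|S| | enum_val j == i) p j.

Lemma extend_alloc_in A j : extend_alloc A (enum_val j) = A j.
Proof.
by rewrite ffunE (big_pred1 j)// => k; rewrite /= (inj_eq enum_val_inj).
Qed.

Lemma extend_alloc_out A i : i \notin S -> extend_alloc A i = finset.set0.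
Proof.
move=> iS; rewrite ffunE big1// => j /eqP ij.
by move: iS; rewrite -ij enum_valP.
Qed.

Lemma extend_pay_in p j : extend_pay p (enum_val j) = p j.
Proof.
by rewrite /extend_pay (big_pred1 j)// => k; rewrite /= (inj_eq enum_val_inj).
Qed.

Lemma extend_pay_out p i : i \notin S -> extend_pay p i = 0.
Proof.
move=> iS; rewrite /extend_pay big1// => j /eqP ij.
by move: iS; rewrite -ij enum_valP.
Qed.

Lemma enum_valE i : i \in S -> exists j : 'I_#|S|, i = enum_val j.
Proof. by move=> iS; exists (enum_rank_in iS i); rewrite enum_rankK_in. Qed.

Lemma extend_alloc_disjoint A : is_allocation A -> is_allocation (extend_alloc A).
Proof.
move=> /forallP aA; apply/forallP => i; apply/forallP => i'; apply/implyP => ii'.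
have [iS|iS] := boolP (i \in S); last first.
  by rewrite (extend_alloc_out _ iS) -finset.setI_eq0 finset.set0I.
have [iS'|iS'] := boolP (i' \in S); last first.
  by rewrite (extend_alloc_out _ iS') -finset.setI_eq0 finset.setI0.
have [j ij] := enum_valE iS; have [j' ij'] := enum_valE iS'.
rewrite ij ij' !extend_alloc_in; have /forallP/(_ j')/implyP := aA j; apply.
by apply: contraNneq ii' => jj'; rewrite ij ij' jj'.
Qed.

Lemma restrict_update_in v j u :
  restrict (update v (enum_val j) u) = update (restrict v) j u.
Proof.
by apply/funext => k; rewrite /restrict /update (inj_eq enum_val_inj).
Qed.

(** A lost item requires an edge between two bidders that both hold items, hence both lie in [S]. *)
Lemma conflict_bundle_extend A i :
  (forall i j, i \in S -> j \in S -> ~~ E i j) ->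
  conflict_bundle E EI (extend_alloc A) i = extend_alloc A i.
Proof.
move=> indep; rewrite /conflict_bundle (_ : conflicting_items _ _ _ _ = finset.set0).
  by rewrite finset.setD0.
apply/finset.setP => k; rewrite !inE.
have [iS|iS] := boolP (i \in S); last by rewrite extend_alloc_out// inE.
apply/negbTE; rewrite negb_and; apply/orP; right.
rewrite negb_exists; apply/forallP => j; rewrite negb_exists; apply/forallP => l.
have [jS|jS] := boolP (j \in S); last by rewrite extend_alloc_out// inE.
by rewrite (negbTE (indep i j iS jS)) andbF.
Qed.

(** Only an inequality, because a bidder outside [S] may have a positive value for the empty set. *)
Lemma welfare_extend v A :
  (forall i j, i \in S -> j \in S -> ~~ E i j) ->
  welfare (@plain_bundle _ _) (restrict v) A <=
  welfare (conflict_bundle E EI) v (extend_alloc A).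
Proof.
move=> indep; rewrite /welfare.
under [leRHS]eq_bigr do rewrite conflict_bundle_extend//.
rewrite [leRHS](bigID (mem S))/=.
rewrite (big_enum_val (fun i => v i (extend_alloc A i))) /=.
under [X in _ <= X + _]eq_bigr do rewrite extend_alloc_in.
by rewrite lerDl sumr_ge0// => i _; exact: val_ge0.
Qed.

(** The bundles of [T] without their conflicting items are still disjoint, so the bidders of [S] can
    be given them in the auction without conflicts. *)
Lemma restricted_optimum (v : profile R n m) (T : bundles n m) : is_allocation T ->
  \sum_(i in S) v i (conflict_bundle E EI T i) <=
  max_welfare (@plain_bundle _ _) (restrict v).
Proof.
move=> aT; rewrite (big_enum_val (fun i => v i (conflict_bundle E EI T i))).
pose T' : bundles #|S| m := [ffun j => conflict_bundle E EI T (enum_val j)].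
have aT' : is_allocation T'.
  apply/forallP => j; apply/forallP => j'; apply/implyP => jj'; rewrite !ffunE.
  have := sub_allocation (T := [ffun i => conflict_bundle E EI T i]) _ aT.
  have sub i : [ffun i => conflict_bundle E EI T i] i \subset T i.
    by rewrite ffunE finset.subsetDl.
  move=> /(_ sub)/forallP/(_ (enum_val j))/forallP/(_ (enum_val j')).
  by rewrite !ffunE (inj_eq enum_val_inj) jj'.
apply: le_trans (max_welfare_ge _ _ aT').
by apply: ler_sum => j _; rewrite /plain_bundle ffunE.
Qed.

End Restriction.
End ConflictMechanism.

Definition read_tuple (K : nat) (s : seq bool) : K.-tuple bool :=
  [tuple nth false s i | i < K].

Lemma read_tupleE K s : (K <= size s)%N -> read_tuple K s = take K s :> seq bool.
Proof.
move=> Ks; apply: (@eq_from_nth _ false); first by rewrite size_tuple size_takel.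
rewrite size_tuple => i iK; rewrite nth_take//.
by rewrite -[i]/(val (Ordinal iK)) -tnth_nth tnth_mktuple.
Qed.

Lemma avg_read_tuple (R : realType) K L (g : K.-tuple bool -> R) : (K <= L)%N ->
  avg L (g \o read_tuple K) = (\sum_w g w) / 2 ^+ K.
Proof.
move=> KL; rewrite -(subnKC KL).
rewrite (eq_avg (g := (g \o read_tuple K) \o take K)) => [|c cL /=]; last first.
  have Kc : (K <= size c)%N by rewrite cL leq_addr.
  by congr g; apply: val_inj; rewrite /= !read_tupleE ?size_takel// take_takel.
rewrite avg_take avg_tuple; congr (_ / _); apply: eq_bigr => w _ /=.
congr g; apply: val_inj.
by rewrite /= read_tupleE ?size_tuple// take_oversize// size_tuple.
Qed.

(** * The mechanism with conflicts: truthfulness and approximation *)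

Section ConflictMechanism.
Variables (R : realType) (M : forall n m, mechanism R n m).
Variables (Kc : nat -> nat -> nat).
Variable phi : forall n m, (Kc n m).-tuple bool -> outcomes (M n m).
Hypothesis phi_law : forall n m A, measurable A ->
  law (M n m) A = (#|[pred c | phi c \in A]|%:R / 2 ^+ Kc n m)%:E.
Variables (b n m : nat) (E : rel 'I_n) (EI : rel 'I_m) (L : nat).
Hypothesis Kc_le : forall k, (k <= n)%N -> (Kc k m <= L)%N.

Let K := (n * b + L)%N.

(** The first [n * b] coins serve the selection. How many coins come next depends on the size of
    [S]; [L] is large enough for all sizes. *)
Definition sub_outcome (S : {set 'I_n}) (c : seq bool) : outcomes (M #|S| m) :=
  phi (read_tuple (Kc #|S| m) (drop (n * b) c)).

Definition conflict_alloc (v : profile R n m) (c : seq bool) : bundles n m :=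
  extend_alloc (alloc (restrict (S := selected b E c) v)
    (sub_outcome (selected b E c) c)).

Definition conflict_pay (v : profile R n m) (c : seq bool) : 'I_n -> R :=
  extend_pay (pay (restrict (S := selected b E c) v)
    (sub_outcome (selected b E c) c)).

Lemma conflict_alloc_disjoint v c : is_allocation (conflict_alloc v c).
Proof. exact/extend_alloc_disjoint/alloc_disjoint. Qed.

Definition conflict_mechanism (K : nat) : mechanism R n m :=
  coin_mechanism K conflict_pay conflict_alloc_disjoint.

Lemma card_set_le (S : {set 'I_n}) : (#|S| <= n)%N.
Proof. by rewrite -[leqRHS]card_ord max_card. Qed.

(** The selection is determined by the first [n * b] coins, so given the selection the remaining
    coins are still uniform. *)
Lemma avg_sub_outcome (G : forall S : {set 'I_n}, outcomes (M #|S| m) -> R) :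
  avg K (fun c => G (selected b E c) (sub_outcome (selected b E c) c)) =
  avg (n * b) (fun c => (\sum_w G (selected b E c) (phi w)) /
                        2 ^+ Kc #|selected b E c| m).
Proof.
rewrite avg_cat; apply: eq_avg => c cn.
rewrite -(avg_read_tuple (G _ \o @phi _ _) (Kc_le (card_set_le (selected b E c)))).
apply: eq_avg => c' _ /=.
have -> : selected b E (c ++ c') = selected b E c.
  have candE (i : 'I_n) : candidate b (c ++ c') i = candidate b c i.
    have ib : (i * b + b <= n * b)%N by rewrite addnC -mulSn leq_mul2r ltn_ord orbT.
    rewrite /candidate drop_cat cn.
    (* A block that starts at or after position [n * b] although [i < n] forces [b = 0], and then
       blocks are empty. *)
    case: ltnP => ibn; last first.
      have b0 : b = 0%N by lia.
      by rewrite b0 !take0.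
    rewrite take_cat size_drop cn; case: ltnP => // ?.
    rewrite [in RHS]take_oversize ?size_drop ?cn; last lia.
    by rewrite (_ : (b - _)%N = 0%N) ?take0 ?cats0//; lia.
  apply/finset.setP => i; rewrite !inE candE; congr (_ && _).
  by apply: eq_forallb => j; rewrite candE.
by rewrite /sub_outcome -cn drop_size_cat.
Qed.

Definition sub_utility (i : 'I_n) (u : valuation R m) (v : profile R n m)
    (S : {set 'I_n}) (w : outcomes (M #|S| m)) : R :=
  u (extend_alloc (alloc (restrict v) w) i) - extend_pay (pay (restrict v) w) i.

Lemma conflict_utility i u v (c : outcomes (conflict_mechanism K)) :
  utility (conflict_bundle E EI) i u v c =
  sub_utility i u v (sub_outcome (selected b E c) c).
Proof.
rewrite /utility /= /conflict_alloc conflict_bundle_extend//.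
by move=> ? ?; exact: selected_independent.
Qed.

Lemma sub_utility_in (S : {set 'I_n}) (j : 'I_#|S|) u v w :
  sub_utility (enum_val j) u v w =
  utility (@plain_bundle _ _) j u (restrict v) w.
Proof. by rewrite /sub_utility extend_alloc_in extend_pay_in. Qed.

Lemma sub_utility_out (S : {set 'I_n}) i u v (w : outcomes (M #|S| m)) :
  i \notin S -> sub_utility i u v w = u finset.set0.
Proof. by move=> iS; rewrite /sub_utility extend_alloc_out// extend_pay_out// subr0. Qed.

(** The comparison is made for each fixed selection, which no report influences: a selected bidder
    faces the given mechanism, and any other bidder has constant utility. *)
Lemma conflict_mechanism_truthful t :
  (forall n m, truthful t (@plain_bundle n m) (M n m)) ->
  truthful t (conflict_bundle E EI) (conflict_mechanism K).
Proof.
case: t => Mt.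
  move=> c i v u; rewrite !conflict_utility.
  have [iS|iS] := boolP (i \in selected b E c); last by rewrite !sub_utility_out.
  have [j ->] := enum_valE iS; rewrite !sub_utility_in restrict_update_in.
  exact: Mt.
split=> [v i|i v u]; first exact: integrable_coin_law.
under eq_fun do rewrite conflict_utility.
under [in leRHS]eq_fun do rewrite conflict_utility.
pose U v' c := sub_utility i (v i) v' (sub_outcome (selected b E c) c).
rewrite (expectation_coins K (U (update v i u))) (expectation_coins K (U v)).
rewrite lee_fin (avg_sub_outcome (@sub_utility i (v i) (update v i u))).
rewrite (avg_sub_outcome (@sub_utility i (v i) v)).
apply: le_avg => c _; set S := selected b E c.
have [iS|iS] := boolP (i \in S); last first.
  under eq_bigr do rewrite sub_utility_out//.
  by under [X in _ <= X / _]eq_bigr do rewrite sub_utility_out//.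
have [j ->] := enum_valE iS.
under eq_bigr do rewrite sub_utility_in restrict_update_in.
under [X in _ <= X / _]eq_bigr do rewrite sub_utility_in.
rewrite -lee_fin -!(expectation_generated (@phi_law _ _)); try exact: utility_measurable.
exact: (Mt _ _).2.
Qed.

(** The given mechanism runs on a possibly smaller number of bidders; monotonicity of [alpha] bounds
    its factor there by [alpha n m]. *)
Lemma conflict_mechanism_approximates (D : nat) (alpha : nat -> nat -> R) :
  (forall n m, 0 < alpha n m) ->
  (forall n n' m : nat, (n <= n')%N -> alpha n m <= alpha n' m) ->
  (forall n m, approximates (@plain_bundle n m) (alpha n m) (M n m)) ->
  (0 < D)%N -> b = coin_depth D ->
  (forall i, ~~ E i i) -> (max_outdegree E <= D)%N ->
  approximates (conflict_bundle E EI) (4 * D%:R * alpha n m)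
    (conflict_mechanism K).
Proof.
move=> a0 amono Ma D0 bD Eirr ED v.
have d0 : 0 < D%:R :> R by rewrite ltr0n.
pose W (S : {set 'I_n}) (w : outcomes (M #|S| m)) : R :=
  welfare (@plain_bundle _ _) (restrict (S := S) v) (alloc (restrict v) w).
rewrite (expectation_coins K
  (fun c => welfare (conflict_bundle E EI) v (conflict_alloc v c))).
rewrite lee_fin.
apply: (@le_trans _ _ (avg K (fun c =>
  W (selected b E c) (sub_outcome (selected b E c) c)))); last first.
  apply: le_avg => c _; apply: welfare_extend.
  by move=> ? ?; exact: selected_independent.
rewrite avg_sub_outcome.
have sel_ge S : is_allocation S ->
    (4 * D%:R * alpha n m)^-1 * welfare (conflict_bundle E EI) v S <=
    avg (n * b) (fun c =>
      (\sum_w W (selected b E c) (phi w)) / 2 ^+ Kc #|selected b E c| m).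
  move=> aS; pose x i := v i (conflict_bundle E EI S i).
  (* Linearity of expectation: the value [x i] is kept with the probability that [i] is selected. *)
  apply: (@le_trans _ _ (avg (n * b) (fun c =>
    (alpha n m)^-1 * \sum_i x i * (i \in selected b E c)%:R))).
    rewrite avgZ avg_sum invfM -mulrA mulrCA ler_wpM2l ?invr_ge0 ?(ltW (a0 _ _))//.
    rewrite /welfare mulr_sumr; apply: ler_sum => i _.
    rewrite avgZ mulrC ler_wpM2l ?val_ge0//.
    rewrite avg_selected// bD; apply: selection_ge => //.
    exact: leq_trans (leq_bigmax i) ED.
  apply: le_avg => c _; set T := selected b E c.
  have := Ma #|T| m (restrict v).
  rewrite (expectation_generated (@phi_law _ _)); last exact: welfare_measurable.
  rewrite lee_fin; apply: le_trans.
  have -> : \sum_i x i * (i \in T)%:R = \sum_(i in T) x i.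
    rewrite [RHS]big_mkcond; apply: eq_bigr => i _.
    by case: (i \in T); rewrite ?mulr1 ?mulr0.
  have max0 : 0 <= max_welfare (@plain_bundle _ _) (restrict (S := T) v).
    apply: le_trans (max_welfare_ge _ _ (empty_allocation _ _)).
    exact: welfare_ge0.
  apply: (@le_trans _ _
    ((alpha n m)^-1 * max_welfare (@plain_bundle _ _) (restrict (S := T) v))).
    by rewrite ler_wpM2l ?invr_ge0 ?(ltW (a0 _ _))// restricted_optimum.
  by rewrite ler_wpM2r// lef_pV2 ?posrE// amono// card_set_le.
rewrite mulrC ler_pdivrMr ?mulr_gt0//.
apply: max_welfare_le => [|S aS].
  rewrite mulr_ge0 ?mulr_ge0 ?(ltW (a0 _ _))//.
  apply: le_trans (sel_ge _ (empty_allocation _ _)).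
  by rewrite mulr_ge0 ?welfare_ge0// invr_ge0 !mulr_ge0// ltW.
by rewrite -ler_pdivrMr ?mulr_gt0// mulrC sel_ge.
Qed.

End ConflictMechanism.

(** * Sets of bidders as increasing lists of naturals *)

Section EnumSeq.
Variables (n : nat) (S : {set 'I_n}).

Definition set_seq : seq nat := [seq val i | i <- enum S].

Lemma size_set_seq : size set_seq = #|S|.
Proof. by rewrite size_map -cardE. Qed.

Lemma set_seq_uniq : uniq set_seq.
Proof. by rewrite map_inj_uniq ?enum_uniq//; exact: val_inj. Qed.

Lemma mem_set_seq (i : 'I_n) : ((i : nat) \in set_seq) = (i \in S).
Proof. by rewrite mem_map ?mem_enum//; exact: val_inj. Qed.

Lemma nth_set_seq x0 (j : 'I_#|S|) : nth x0 set_seq j = enum_val j.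
Proof.
by rewrite (nth_map (enum_default j)) -?cardE// -enum_val_nth.
Qed.

Lemma index_set_seq (j : 'I_#|S|) : index (enum_val j : nat) set_seq = j.
Proof.
by rewrite -(nth_set_seq 0) index_uniq ?size_set_seq ?set_seq_uniq.
Qed.

(** The scan of the program and [enum] both go through the bidders in increasing order, so the
    program numbers the selected bidders as [enum_val] does. *)
Lemma set_seqE : set_seq =
  [seq i <- iota 0 n | if insub i is Some j then (j : 'I_n) \in S else false].
Proof.
rewrite -val_enum_ord filter_map /set_seq; congr map.
rewrite {1}/enum_mem -enumT; apply: eq_filter => i /=.
by rewrite valK.
Qed.

End EnumSeq.

(** * The program computes the mechanism with conflicts *)

Section Compute.
Variables (R : realType) (q : query_model R) (M : forall n m, mechanism R n m).
Variables (p : prog) (Kc : nat -> nat -> nat).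
Variable phi : forall n m, (Kc n m).-tuple bool -> outcomes (M n m).
Hypothesis phi_run : forall n m (v : profile R n m) (c : (Kc n m).-tuple bool),
  exists (t : nat) (st : state R),
  [/\ exec (make_input q (@no_edge n) (@no_edge m) v) p (init_state R c) t st,
      (t <= Kc n m)%N, out_alloc n m st = alloc v (phi c) &
      forall i, out_pay st i = pay v (phi c) i].
Variables (b n m : nat) (E : rel 'I_n) (EI : rel 'I_m) (L : nat).
Hypothesis Kc_le : forall k, (k <= n)%N -> (Kc k m <= L)%N.

Lemma edge_code_no_edge k i j : edge_code (@no_edge k) i j = false.
Proof. by rewrite /edge_code; do 2 case: insub => //. Qed.

Lemma conflict_prog_computes K : (n * b + L <= K)%N ->
  (L + (8 + n * (2 * b + n * 4 + 15) + m * 3) <= K)%N ->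
  computes q (conflict_prog b p) E EI
    (conflict_mechanism phi b m E K) K.
Proof.
(* The realizations of this mechanism are the coin tuples themselves, hence [id]. *)
move=> nbK timeK; exists id; split => [A _|v c]; first exact: coin_lawE.
set S := selected b E c; set rest := drop (n * b) c.
have kS : (Kc #|S| m <= L)%N by exact/Kc_le/card_set_le.
have szrest : (Kc #|S| m <= size rest)%N by rewrite size_drop size_tuple; lia.
have [t [st' [ex tK allocE payE]]] :=
  phi_run (restrict (S := S) v) (read_tuple (Kc #|S| m) rest).
pose sel i := if insub i is Some j then (j : 'I_n) \in S else false.
have selE i : (i < n)%N -> sel i = candidate b c i &&
    all (fun j => ~~ (edge_code E i j && candidate b c j)) (iota 0 n).
  move=> iN; have ins k (kn : (k < n)%N) : insub k = Some (Ordinal kn) :> option 'I_n.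
    by rewrite insubT.
  rewrite /sel ins inE /=; congr (_ && _).
  apply/forallP/allP => [h j|h j].
    rewrite mem_iota => /andP[_ jn]; rewrite /edge_code (ins _ iN) (ins _ jn) /=.
    by have := h (Ordinal jn); case: (E _ _).
  have := h j; rewrite mem_iota ltn_ord /edge_code (ins _ iN) valK /= => /(_ isT).
  by case: (E _ _).
have LE : selection sel n = set_seq S by rewrite set_seqE.
have bcoins : drop (n * b) c =
    tval (read_tuple (Kc #|S| m) rest) ++ drop (Kc #|S| m) rest.
  by rewrite read_tupleE// cat_take_drop.
have := @conflict_prog_correct R (make_input q E EI v) b c sel selE
  (make_input q (@no_edge #|S|) (@no_edge m) (restrict (S := S) v)) p
  _ _ _ _ _ _ _ bcoins t st' ex.
rewrite /= LE size_set_seq => /(_ erefl erefl).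
move=> /(_ (@edge_code_no_edge _) (@edge_code_no_edge _)).
case.
- move=> e msg; have [eS|eS] := ltnP e #|S|.
    by rewrite (nth_set_seq _ (Ordinal eS)) valK insubT.
  (* A query to a nonexistent bidder of the small auction is sent to index [n]; both sides answer
     with empty lists. *)
  rewrite nth_default ?size_set_seq// insubF ?ltnn// insubF//.
  by apply/negbTE; rewrite -leqNgt.
- by rewrite size_map size_enum_ord.
move=> t' [st [exF tF natF realF]].
exists t', st; split => //.
- by lia.
- apply/ffunP => i; rewrite ffunE /= /conflict_alloc -/S.
  have [iS|iS] := boolP (i \in S).
    have [j ->] := enum_valE iS; rewrite extend_alloc_in.
    rewrite /sub_outcome -/rest -allocE ffunE; apply/finset.setP => k; rewrite !inE.
    (* An entry 0, or [y + 1] with [y] not below the number of selected bidders, decodes to [n],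
       which is no bidder. *)
    rewrite natF// eqSS; case: (nats st' 0 k) => [|y] /=.
      by apply/negbTE; rewrite neq_ltn ltn_ord orbT.
    rewrite eqSS; have [yS|yS] := ltnP y #|S|.
      rewrite (nth_set_seq _ (Ordinal yS)) (inj_eq val_inj).
      by rewrite (inj_eq enum_val_inj).
    rewrite nth_default ?size_set_seq//; apply/idP/idP => /eqP h.
      by have := ltn_ord (enum_val j); rewrite -h ltnn.
    by move: yS; rewrite h leqNgt ltn_ord.
  rewrite extend_alloc_out//; apply/finset.setP => k; rewrite !inE.
  rewrite natF// eqSS; apply: contraNF iS => /eqP h.
  rewrite -mem_set_seq -h; case: (nats st' 0 k) h => [|y] /= h.
    by have := ltn_ord i; rewrite -h ltnn.
  apply: mem_nth; rewrite ltnNge; apply: contraT => /negPn yS.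
  by have := ltn_ord i; rewrite -h nth_default ?ltnn.
- move=> i; rewrite /out_pay realF//= /conflict_pay -/S mem_set_seq.
  case: (boolP (i \in S)) => iS; last by rewrite extend_pay_out.
  have [j ->] := enum_valE iS; rewrite extend_pay_in index_set_seq.
  by rewrite /sub_outcome -/rest -payE.
Qed.

End Compute.

Theorem corollary4 (R : realType) (t : truthfulness) (q : query_model R)
    (Delta : nat) (alpha : nat -> nat -> R)
    (M : forall n m : nat, mechanism R n m) :
  (1 <= Delta)%N ->
  (forall n m : nat, 0 < alpha n m) ->
  (forall n n' m : nat, (n <= n')%N -> alpha n m <= alpha n' m) ->
  (forall n m : nat, truthful t (@plain_bundle n m) (M n m)) ->
  (forall n m : nat, approximates (@plain_bundle n m) (alpha n m) (M n m)) ->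
  exists M' : forall (n m : nat) (E : rel 'I_n) (EI : rel 'I_m),
      mechanism R n m,
    (forall (n m : nat) (E : rel 'I_n) (EI : rel 'I_m),
       max_outdegree E = Delta ->
       truthful t (conflict_bundle E EI) (M' n m E EI) /\
       approximates (conflict_bundle E EI) (4 * Delta%:R * alpha n m)
         (M' n m E EI)) /\
    (polytime q M -> polytime_conflict q Delta M').
Proof.
move=> D0 a0 amono Mt Ma.
have d1 : 1 <= Delta%:R :> R by rewrite ler1n.
have groves_ok n m (E : rel 'I_n) (EI : rel 'I_m) :
    truthful t (conflict_bundle E EI) (groves R (conflict_bundle E EI)) /\
    approximates (conflict_bundle E EI) (4 * Delta%:R * alpha n m)
      (groves R (conflict_bundle E EI)).
  split; first exact: groves_truthful.
  have an := a0 n m.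
  apply: groves_approximates; first by rewrite !mulr_gt0//; lra.
  have [->|n0] := posnP n; [by left | right].
  have a1 := approximates_ge1 an n0 (Ma n m).
  by rewrite -[leLHS]mulr1; apply: ler_pM => //; lra.
have [|nopoly] := pselect (polytime q M); last first.
  by exists (fun n m E EI => groves R (conflict_bundle E EI)).
move=> [p [c [d run]]].
pose Kc n m := (c * (n + m + 1) ^ d)%N.
pose phi n m := projT1 (cid (run n m)).
have phiP n m := projT2 (cid (run n m)).
pose b := coin_depth Delta.
(* The two additional powers absorb the quadratic cost of the selection. *)
pose K n m := ((c + 2 * b + 30) * (n + m + 1) ^ (d + 2))%N.
have Kc_le n m k : (k <= n)%N -> (Kc k m <= Kc n m)%N.
  move=> kn; apply: leq_mul => //.
  by case: (d) => [|e]; rewrite ?expn0// leq_exp2r//; lia.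
have bounds n m : (n * b + Kc n m <= K n m)%N /\
    (Kc n m + (8 + n * (2 * b + n * 4 + 15) + m * 3) <= K n m)%N.
  rewrite /Kc /K expnD; set N := (n + m + 1)%N; set P := (N ^ d)%N.
  have P0 : (0 < P)%N by rewrite expn_gt0 /N addn1.
  have N0 : (1 <= N ^ 2)%N by rewrite expn_gt0 /N addn1.
  have cP : (c * P <= c * (P * N ^ 2))%N by rewrite leq_mul2l leq_pmulr ?orbT.
  have nP : (8 + n * (2 * b + n * 4 + 15) + m * 3 + n * b <=
      (2 * b + 30) * (P * N ^ 2))%N.
    apply: (@leq_trans ((2 * b + 30) * N ^ 2)%N).
      by rewrite /N; nia.
    by rewrite leq_mul2l leq_pmull ?orbT.
  by split; lia.
exists (fun n m E EI => if [forall i, ~~ E i i]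
  then conflict_mechanism phi b m E (K n m) else groves R (conflict_bundle E EI)).
split=> [n m E EI ED|_].
  case: ifPn => [/forallP Eirr|_]; last exact: groves_ok.
  have [KE _] := bounds n m.
  have phi_law k l A : measurable A -> law (M k l) A = _ := (phiP k l).1 A.
  (* All coins left after the selection; those that the given mechanism does not read average
     out. *)
  pose L := (K n m - n * b)%N.
  have KL : K n m = (n * b + L)%N by rewrite subnKC//; lia.
  have KcL k : (k <= n)%N -> (Kc k m <= L)%N.
    by move=> /(Kc_le _ m); rewrite /L; lia.
  rewrite KL; split; first exact: conflict_mechanism_truthful.
  by apply: conflict_mechanism_approximates => //; rewrite ED.
exists (conflict_prog b p), (c + 2 * b + 30)%N, (d + 2)%N => n m E EI Eirr ED.
rewrite ifT; last by apply/forallP => i; rewrite Eirr.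
have [K1 K2] := bounds n m.
apply: (@conflict_prog_computes _ q M p Kc phi _ b n m E EI (Kc n m)) => //.
- by move=> k l v w; exact: (phiP k l).2.
- by move=> k; exact: Kc_le.
Qed.
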